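(* Let $V$ be the component of the free partially alternating ternary algebra over $\mathbb{Q}$ on $\{a,b,c,d,e,f\}$ spanned by the degree 7 monomials whose variables are a permutation of $a,a,b,c,d,e,f$, and let $N\subseteq V$ be the subspace of elements $h$ such that $h\equiv 0$ is satisfied by the partially alternating ternary sum. Then there are 12 identities for the partition $211111$, of which only 5 have 60 terms; that is, $\dim N=12$, and exactly 5 of the 12 elements of the canonical basis of $N$ have 60 terms. Up to nonzero scalar multiples these 5 are $$I_{211111}^{(1)}=\frac14\sum_{\sigma\in S_5}\epsilon(\sigma)[[[b\,a^\sigma c^\sigma]\,a\,d^\sigma]\,e^\sigma f^\sigma]-\frac1{12}\sum_{\sigma\in S_5}\epsilon(\sigma)[[b\,[a^\sigma c^\sigma d^\sigma]\,a]\,e^\sigma f^\sigma]$$ $$\qquad-\frac1{12}\sum_{\sigma\in S_5}\epsilon(\sigma)[[b\,a^\sigma c^\sigma]\,[d^\sigma e^\sigma f^\sigma]\,a]-\frac16\sum_{\sigma\in S_5}\epsilon(\sigma)[b\,[[a^\sigma c^\sigma d^\sigma]\,a\,e^\sigma]\,f^\sigma],$$ and $I_{211111}^{(2)},\dots,I_{211111}^{(5)}$, obtained from $I_{211111}^{(1)}$ by interchanging $b$ with $c$, $d$, $e$, $f$ respectively. Here $S_5$ acts on $\{a,c,d,e,f\}$, the symbols $a,b$ without superscript are not permuted by $\sigma$, and $[xyz]$ denotes the ternary product.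
   Context: The base field is $\mathbb{Q}$. An (associative) dialgebra is a vector space $A$ with two bilinear products $\dashv,\vdash$ satisfying $(a\dashv b)\dashv c=a\dashv(b\dashv c)$, $(a\vdash b)\vdash c=a\vdash(b\vdash c)$, $(a\vdash b)\dashv c=a\vdash(b\dashv c)$, $(a\dashv b)\vdash c=(a\vdash b)\vdash c$, $a\dashv(b\dashv c)=a\dashv(b\vdash c)$. The partially alternating ternary sum (PATS) is the trilinear operation on a dialgebra $$[a,b,c]=a\dashv b\dashv c-a\dashv c\dashv b-b\vdash a\dashv c+c\vdash a\dashv b+b\vdash c\vdash a-c\vdash b\vdash a .$$ A ternary algebra is a vector space with a trilinear product. A partially alternating ternary algebra (PATA) is a ternary algebra satisfying $[x,y,z]+[x,z,y]=0$ and $[v,[w,x,y],z]+[v,[x,w,y],z]=0$; every dialgebra is a PATA under the PATS. The free PATA is the quotient of the free ternary algebra by all consequences of these two identities. For an element $h$ of the free PATA, $h\equiv0$ is satisfied by the PATS if $h$ vanishes for all values of the variables in every dialgebra, with the ternary product interpreted as the PATS. A basis of the degree 7 part of the free PATA (with totally ordered generators) is given by the straightened monomials (1) $[[[x_1x_2x_3]x_4x_5]x_6x_7]$ with $x_2<x_3$, $x_4<x_5$, $x_6<x_7$; (2) $[[x_1[x_2x_3x_4]x_5]x_6x_7]$ with $x_2<x_3<x_4$, $x_6<x_7$; (3) $[[x_1x_2x_3][x_4x_5x_6]x_7]$ with $x_2<x_3$, $x_4<x_5<x_6$; (4) $[x_1[[x_2x_3x_4]x_5x_6]x_7]$ with $x_2<x_3<x_4$,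 $x_5<x_6$; (5) $[x_1[x_2x_3x_4][x_5x_6x_7]]$ with $x_2<x_3<x_4$, $x_5<x_6<x_7$ and $(x_2,x_3,x_4)<(x_5,x_6,x_7)$ lexicographically. The number of terms of an element is the number of straightened monomials with nonzero coefficient when it is written in this basis. Order the straightened monomials in $V$ by type (1) to (5), and within each type lexicographically by the sequence $x_1\cdots x_7$. The subspace $N$ is the nullspace of the expansion matrix $E$, whose columns are the coordinate vectors, in the free dialgebra, of the PATS expansions of these straightened monomials in this order. The canonical basis of $N$ is obtained from the row canonical form (reduced row echelon form) of $E$ by setting each free variable in turn equal to 1 and the other free variables equal to 0 and solving for the leading variables. Here $a<b<\cdots$, $\epsilon(\sigma)$ is the sign of $\sigma$, and $x^\sigma$ is the image of $x$ under $\sigma$. *)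

(* Defs.v *)
From HB Require Import structures.
From mathcomp Require Import all_boot all_order all_fingroup all_algebra finmap.
From mathcomp Require Import generic_quotient ring_quotient.
From mathcomp Require Import boolp classical_sets.
From mathcomp Require Import monalg.

Set Implicit Arguments.
Unset Strict Implicit.
Unset Printing Implicit Defensive.

Import GRing.Theory.

Local Open Scope ring_scope.
Local Open Scope quotient_scope.

Section LinearExtension.
Variables (K : choiceType) (U : lmodType rat).
Implicit Types (f g : K -> U) (u v : {malg rat[K]}).

Definition lin_ext f u : U := \sum_(k <- msupp u) u@_k *: f k.

Lemma lin_extEw f u (D : {fset K}) : (msupp u `<=` D)%fset ->
  lin_ext f u = \sum_(k <- D) u@_k *: f k.
Proof.
move=> sD; rewrite /lin_ext (big_fset_incl _ sD) // => k _ /mcoeff_outdom ->.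
by rewrite scale0r.
Qed.

Lemma lin_ext_is_linear f : linear (lin_ext f).
Proof.
move=> c u v; pose D := (msupp (c *: u + v) `|` (msupp u `|` msupp v))%fset.
have [sL [su sv]] : (msupp (c *: u + v)%R `<=` D)%fset /\
    (msupp u `<=` D)%fset /\ (msupp v `<=` D)%fset.
  rewrite /D fsubsetUl; do ! split; rewrite // fsubsetU //.
    by rewrite fsubsetUl orbT.
  by rewrite fsubsetUr orbT.
rewrite (lin_extEw _ sL) (lin_extEw _ su) (lin_extEw _ sv).
rewrite scaler_sumr -big_split /=; apply: eq_bigr => k _.
by rewrite mcoeffD mcoeffZ scalerDl scalerA.
Qed.

HB.instance Definition _ f :=
  GRing.isLinear.Build rat {malg rat[K]} U _ (lin_ext f) (lin_ext_is_linear f).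

Lemma lin_extU f k : lin_ext f << k >> = f k.
Proof.
rewrite (@lin_extEw f _ [fset k]%fset) ?msuppU_le //.
by rewrite big_seq_fset1 mcoeffUU scale1r.
Qed.

Lemma lin_extP f c g h u : (forall k, h k = c *: f k + g k) ->
  lin_ext h u = c *: lin_ext f u + lin_ext g u.
Proof.
move=> hE; rewrite /lin_ext scaler_sumr -big_split /=; apply: eq_bigr => k _.
by rewrite hE scalerDr !scalerA mulrC.
Qed.

Lemma eq_lin_ext f g : f =1 g -> lin_ext f =1 lin_ext g.
Proof. by move=> fg u; apply: eq_bigr => k _; rewrite fg. Qed.

End LinearExtension.

Lemma linear_at0 (U V : lmodType rat) (f : U -> V) : linear f -> f 0 = 0.
Proof. by move=> fL; have := fL (-1) 0 0; rewrite scaler0 addr0 scaleN1r addNr. Qed.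

Lemma lin_ext_comp (K : choiceType) (U V : lmodType rat) (phi : U -> V)
    (f : K -> U) u :
  linear phi -> phi (lin_ext f u) = lin_ext (fun k => phi (f k)) u.
Proof.
move=> phiL; rewrite /lin_ext; elim/big_rec2: _ => [|k x y _ <-].
  exact: linear_at0.
by rewrite phiL.
Qed.

Definition trilinear (U : lmodType rat) (m : U -> U -> U -> U) :=
  [/\ forall y z, linear (fun x => m x y z),
      forall x z, linear (fun y => m x y z)
    & forall x y, linear (fun z => m x y z)].

Record ternaryAlgebra := TernaryAlgebra {
  tcar :> lmodType rat;
  tprod : tcar -> tcar -> tcar -> tcar;
  tprod_trilinear : trilinear tprod
}.

Definition isPATA (A : ternaryAlgebra) :=
  (forall x y z : A, tprod x y z + tprod x z y = 0) /\
  (forall v w x y z : A,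
     tprod v (tprod w x y) z + tprod v (tprod x w y) z = 0).

Inductive tmon (X : Type) := TVar of X | TNode of tmon X & tmon X & tmon X.

Fixpoint tleaves X (t : tmon X) : seq X :=
  match t with
  | TVar x => [:: x]
  | TNode t1 t2 t3 => tleaves t1 ++ tleaves t2 ++ tleaves t3
  end.

Fixpoint tmon_eval X (A : ternaryAlgebra) (x : X -> A) (t : tmon X) : A :=
  match t with
  | TVar i => x i
  | TNode t1 t2 t3 => tprod (tmon_eval x t1) (tmon_eval x t2) (tmon_eval x t3)
  end.

Section TmonChoice.
Variable X : choiceType.

Fixpoint tmon_code (t : tmon X) : GenTree.tree X :=
  match t with
  | TVar x => GenTree.Leaf x
  | TNode t1 t2 t3 =>
      GenTree.Node 0 [:: tmon_code t1; tmon_code t2; tmon_code t3]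
  end.

Fixpoint tmon_decode (t : GenTree.tree X) : option (tmon X) :=
  match t with
  | GenTree.Leaf x => Some (TVar x)
  | GenTree.Node _ [:: t1; t2; t3] =>
      match tmon_decode t1, tmon_decode t2, tmon_decode t3 with
      | Some u1, Some u2, Some u3 => Some (TNode u1 u2 u3)
      | _, _, _ => None
      end
  | _ => None
  end.

Lemma tmon_codeK : pcancel tmon_code tmon_decode.
Proof. by elim=> //= t1 -> t2 -> t3 ->. Qed.

HB.instance Definition _ := Choice.copy (tmon X) (pcan_type tmon_codeK).
End TmonChoice.

Section FreeTernary.
Variable X : choiceType.

Definition FT : lmodType rat := {malg rat[tmon X]}.

Definition FT_prod (u v w : FT) : FT :=
  lin_ext (fun s => lin_ext (fun t => lin_ext (fun r =>
    << TNode s t r >> : FT) w) v) u.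

Lemma FT_prod_trilinear : trilinear FT_prod.
Proof.
split=> [v w|u w|u v] c x y; rewrite /FT_prod.
- exact: linearP.
- by apply: lin_extP => s; rewrite linearP.
- by apply: lin_extP => s; apply: lin_extP => t; rewrite linearP.
Qed.

Lemma FT_prodU s t r : FT_prod << s >> << t >> << r >> = << TNode s t r >>.
Proof. by rewrite /FT_prod !lin_extU. Qed.

Definition freeTernary := TernaryAlgebra FT_prod_trilinear.

Variables (A : ternaryAlgebra) (x : X -> A).

Definition FT_eval : freeTernary -> A := lin_ext (tmon_eval x).

Lemma FT_eval_is_linear : linear FT_eval.
Proof. exact: lin_ext_is_linear. Qed.

Lemma FT_evalU t : FT_eval << t >> = tmon_eval x t.
Proof. exact: lin_extU. Qed.

Lemma FT_eval_prod u v w :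
  FT_eval (tprod u v w) = tprod (FT_eval u) (FT_eval v) (FT_eval w).
Proof.
have [n1 n2 n3] := tprod_trilinear A; have L := FT_eval_is_linear.
rewrite [tprod u v w]/(FT_prod u v w) /FT_prod (lin_ext_comp _ _ L).
rewrite [in RHS]/FT_eval (lin_ext_comp _ _ (n1 _ _)).
apply: eq_lin_ext => s; rewrite (lin_ext_comp _ _ L) (lin_ext_comp _ _ (n2 _ _)).
apply: eq_lin_ext => t; rewrite (lin_ext_comp _ _ L) (lin_ext_comp _ _ (n3 _ _)).
by apply: eq_lin_ext => r; exact: FT_evalU.
Qed.

End FreeTernary.

(* The quotient of a ternary algebra by all consequences of the defining      *)
(* identities of PATAs.                                                       *)
Section PATAQuotient.
Variable A : ternaryAlgebra.

Inductive pata_consequence : A -> Prop :=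
| PC_alt x y z : pata_consequence (tprod x y z + tprod x z y)
| PC_inner v w x y z : pata_consequence
    (tprod v (tprod w x y) z + tprod v (tprod x w y) z)
| PC_zero : pata_consequence 0
| PC_lin c u v : pata_consequence u -> pata_consequence v ->
    pata_consequence (c *: u + v)
| PC_prod1 u y z : pata_consequence u -> pata_consequence (tprod u y z)
| PC_prod2 x u z : pata_consequence u -> pata_consequence (tprod x u z)
| PC_prod3 x y u : pata_consequence u -> pata_consequence (tprod x y u).

Definition pata_ideal : {pred A} := fun u => `[< pata_consequence u >].

Lemma pata_idealP u : reflect (pata_consequence u) (u \in pata_ideal).
Proof. exact: asboolP. Qed.

Lemma pata_ideal_zmod_closed : zmod_closed pata_ideal.
Proof.
split=> [|u v /pata_idealP Pu /pata_idealP Pv]; apply/pata_idealP.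
  exact: PC_zero.
by rewrite -[u - v]addrC -scaleN1r; apply: PC_lin.
Qed.

HB.instance Definition _ :=
  GRing.isZmodClosed.Build A pata_ideal pata_ideal_zmod_closed.

Definition quot_car := {ideal_quot pata_ideal}.
HB.instance Definition _ := GRing.Zmodule.on quot_car.

Definition to_quot (u : A) : quot_car := \pi_quot_car u.
Definition of_quot (h : quot_car) : A := repr h.

Lemma of_quotK h : to_quot (of_quot h) = h. Proof. exact: reprK. Qed.

Lemma to_quot_eq u v : to_quot u = to_quot v <-> pata_consequence (u - v).
Proof.
have E : (u - v \in pata_ideal) = (to_quot u == to_quot v).
  exact: (Quotient.idealrBE pata_ideal u v).
split=> [/eqP|Puv]; first by rewrite -E => /pata_idealP.
by apply/eqP; rewrite -E; apply/pata_idealP.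
Qed.

Lemma of_quot_consequence u : pata_consequence (of_quot (to_quot u) - u).
Proof. by apply/to_quot_eq; rewrite of_quotK. Qed.

Let to_quotD u v : to_quot (u + v) = to_quot u + to_quot v.
Proof. by rewrite /to_quot piE. Qed.

Lemma to_quot0 : to_quot 0 = 0. Proof. by rewrite /to_quot piE. Qed.

Definition quot_scale (c : rat) (h : quot_car) := to_quot (c *: of_quot h).

Let to_quotZ c u : quot_scale c (to_quot u) = to_quot (c *: u).
Proof.
apply/to_quot_eq; rewrite -scalerBr -[_ *: _]addr0.
by apply: PC_lin PC_zero; exact: of_quot_consequence.
Qed.

Let quot_scaleA c d h : quot_scale c (quot_scale d h) = quot_scale (c * d) h.
Proof. by rewrite -[h]of_quotK !to_quotZ scalerA. Qed.

Let quot_scale1 : left_id 1 quot_scale.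
Proof. by move=> h; rewrite -[h]of_quotK to_quotZ scale1r. Qed.

Let quot_scaleDr : right_distributive quot_scale +%R.
Proof.
move=> c h k; rewrite -[h]of_quotK -[k]of_quotK -to_quotD !to_quotZ.
by rewrite scalerDr to_quotD.
Qed.

Let quot_scaleDl h : {morph quot_scale^~ h : c d / c + d}.
Proof.
by move=> c d; rewrite -[h]of_quotK !to_quotZ scalerDl to_quotD.
Qed.

HB.instance Definition _ := GRing.Zmodule_isLmodule.Build rat quot_car
  quot_scaleA quot_scale1 quot_scaleDr quot_scaleDl.

Lemma to_quot_is_linear : linear to_quot.
Proof. by move=> c u v; rewrite to_quotD -to_quotZ. Qed.

Definition quot_prod (x y z : quot_car) : quot_car :=
  to_quot (tprod (of_quot x) (of_quot y) (of_quot z)).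

Let tprod_sub (x y z x' y' z' : A) : tprod x y z - tprod x' y' z' =
  tprod (x - x') y z + (tprod x' (y - y') z + tprod x' y' (z - z')).
Proof.
have [m1 m2 m3] := tprod_trilinear A.
have e1 (a b c d : A) : tprod (a - b) c d = tprod a c d - tprod b c d.
  by have := m1 c d (-1) b a; rewrite !scaleN1r ![- _ + _]addrC.
have e2 (a b c d : A) : tprod a (b - c) d = tprod a b d - tprod a c d.
  by have := m2 a d (-1) c b; rewrite !scaleN1r ![- _ + _]addrC.
have e3 (a b c d : A) : tprod a b (c - d) = tprod a b c - tprod a b d.
  by have := m3 a b (-1) d c; rewrite !scaleN1r ![- _ + _]addrC.
by rewrite e1 e2 e3 !addrA !subrK.
Qed.

Let PC_add u v :
  pata_consequence u -> pata_consequence v -> pata_consequence (u + v).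
Proof. by move=> Pu Pv; rewrite -[u]scale1r; apply: PC_lin. Qed.

Let to_quot_prod u v w :
  quot_prod (to_quot u) (to_quot v) (to_quot w) = to_quot (tprod u v w).
Proof.
apply/to_quot_eq; rewrite tprod_sub.
apply: PC_add; first by apply: PC_prod1; exact: of_quot_consequence.
apply: PC_add; first by apply: PC_prod2; exact: of_quot_consequence.
by apply: PC_prod3; exact: of_quot_consequence.
Qed.

Let quot_linear (m : A -> A) (M : quot_car -> quot_car) :
  linear m -> (forall u, M (to_quot u) = to_quot (m u)) -> linear M.
Proof.
move=> mL ME c h k; rewrite -[h]of_quotK -[k]of_quotK.
by rewrite -to_quot_is_linear !ME mL to_quot_is_linear.
Qed.

Lemma quot_prod_trilinear : trilinear quot_prod.
Proof.
have [m1 m2 m3] := tprod_trilinear A.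
split=> [y z|x z|x y].
- rewrite -[y]of_quotK -[z]of_quotK.
  by apply: (quot_linear (m1 _ _)) => u; exact: to_quot_prod.
- rewrite -[x]of_quotK -[z]of_quotK.
  by apply: (quot_linear (m2 _ _)) => u; exact: to_quot_prod.
- rewrite -[x]of_quotK -[y]of_quotK.
  by apply: (quot_linear (m3 _ _)) => u; exact: to_quot_prod.
Qed.

Definition pata_quotient := TernaryAlgebra quot_prod_trilinear.

Definition pata_pi : A -> pata_quotient := to_quot.
Definition pata_repr : pata_quotient -> A := of_quot.

Lemma pata_reprK h : pata_pi (pata_repr h) = h.
Proof. exact: of_quotK. Qed.

Lemma pata_pi_eq u v : pata_pi u = pata_pi v <-> pata_consequence (u - v).
Proof. exact: to_quot_eq. Qed.

Lemma pata_pi_is_linear : linear pata_pi.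
Proof. exact: to_quot_is_linear. Qed.

Lemma pata_pi_prod u v w :
  tprod (pata_pi u) (pata_pi v) (pata_pi w) = pata_pi (tprod u v w).
Proof. exact: to_quot_prod. Qed.

Lemma pata_quotient_isPATA : isPATA pata_quotient.
Proof.
have D u v : pata_pi u + pata_pi v = pata_pi (u + v).
  by have := pata_pi_is_linear 1 u v; rewrite !scale1r.
have Z u : pata_consequence u -> pata_pi u = 0.
  rewrite -[0]to_quot0 => Pu; apply/pata_pi_eq.
  by rewrite subr0.
split=> [x y z|v w x y z].
  rewrite -[x]pata_reprK -[y]pata_reprK -[z]pata_reprK !pata_pi_prod D.
  by apply: Z; exact: PC_alt.
rewrite -[v]pata_reprK -[w]pata_reprK -[x]pata_reprK -[y]pata_reprK.
rewrite -[z]pata_reprK !pata_pi_prod D.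
by apply: Z; exact: PC_inner.
Qed.

Section Lift.
Variables (B : ternaryAlgebra) (phi : A -> B).
Hypotheses (BPATA : isPATA B) (phiL : linear phi).
Hypothesis phiM : forall u v w,
  phi (tprod u v w) = tprod (phi u) (phi v) (phi w).

Lemma pata_lift_consequence u : pata_consequence u -> phi u = 0.
Proof.
have [n1 n2 n3] := tprod_trilinear B; have [B1 B2] := BPATA.
have D x y : phi (x + y) = phi x + phi y.
  by have := phiL 1 x y; rewrite !scale1r.
elim=> [x y z|v w x y z||c {}u v _ IHu _ IHv|v y z _ IH|x v z _ IH|x y v _ IH].
- by rewrite D !phiM B1.
- by rewrite D !phiM B2.
- exact: linear_at0.
- by rewrite phiL IHu IHv scaler0 addr0.
- by rewrite phiM IH (linear_at0 (n1 _ _)).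
- by rewrite phiM IH (linear_at0 (n2 _ _)).
- by rewrite phiM IH (linear_at0 (n3 _ _)).
Qed.

Lemma pata_liftE u : phi (pata_repr (pata_pi u)) = phi u.
Proof.
have /pata_lift_consequence := of_quot_consequence u.
rewrite -[_ - u]addrC -scaleN1r phiL scaleN1r addrC => /eqP.
by rewrite subr_eq0 => /eqP.
Qed.

End Lift.
End PATAQuotient.

Section FreePATA.
Variable X : choiceType.

Definition freePATA := pata_quotient (freeTernary X).

Lemma freePATA_isPATA : isPATA freePATA.
Proof. exact: pata_quotient_isPATA. Qed.

Definition PATA_mon (t : tmon X) : freePATA :=
  @pata_pi (freeTernary X) << t >>.
Definition PATA_gen (x : X) : freePATA := PATA_mon (TVar x).

Lemma PATA_monE t : PATA_mon t = tmon_eval PATA_gen t.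
Proof.
elim: t => //= t1 <- t2 <- t3 <-.
rewrite -[LHS]/(@pata_pi (freeTernary X) << TNode t1 t2 t3 >>) -FT_prodU.
exact/esym/(@pata_pi_prod (freeTernary X)).
Qed.

Variables (A : ternaryAlgebra) (x : X -> A).

(* The choice of representative is immaterial when A is a PATA: see           *)
(* PATA_eval_pi below.                                                        *)
Definition PATA_eval (h : freePATA) : A := FT_eval x (pata_repr h).

Hypothesis APATA : isPATA A.

Lemma PATA_eval_pi u : PATA_eval (pata_pi u) = FT_eval x u.
Proof.
by apply: pata_liftE => //; [exact: FT_eval_is_linear | exact: FT_eval_prod].
Qed.

Lemma PATA_eval_mon t : PATA_eval (PATA_mon t) = tmon_eval x t.
Proof. by rewrite PATA_eval_pi FT_evalU. Qed.

Lemma PATA_eval_is_linear : linear PATA_eval.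
Proof.
move=> c h k; rewrite -(pata_reprK h) -(pata_reprK k).
rewrite -(pata_pi_is_linear c (pata_repr h) (pata_repr k)).
rewrite (PATA_eval_pi (_ + _)) (FT_eval_is_linear x c).
by rewrite (PATA_eval_pi (pata_repr h)) (PATA_eval_pi (pata_repr k)).
Qed.

Lemma PATA_eval_prod h k l :
  PATA_eval (tprod h k l) = tprod (PATA_eval h) (PATA_eval k) (PATA_eval l).
Proof.
rewrite -(pata_reprK h) -(pata_reprK k) -(pata_reprK l) pata_pi_prod.
by rewrite !PATA_eval_pi FT_eval_prod.
Qed.

End FreePATA.

Declare Scope dialgebra_scope.
Delimit Scope dialgebra_scope with dia.
Reserved Notation "x ⊣ y" (at level 40, left associativity).
Reserved Notation "x ⊢ y" (at level 40, left associativity).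

Record dialgebra := Dialgebra {
  dcar :> lmodType rat;
  dleft : dcar -> dcar -> dcar;
  dright : dcar -> dcar -> dcar;
  dleft_linear1 : forall b, linear (fun a => dleft a b);
  dleft_linear2 : forall a, linear (dleft a);
  dright_linear1 : forall b, linear (fun a => dright a b);
  dright_linear2 : forall a, linear (dright a);
  dleftA : forall a b c, dleft (dleft a b) c = dleft a (dleft b c);
  drightA : forall a b c, dright (dright a b) c = dright a (dright b c);
  dinnerA : forall a b c, dleft (dright a b) c = dright a (dleft b c);
  dright_bar : forall a b c, dright (dleft a b) c = dright (dright a b) c;
  dleft_bar : forall a b c, dleft a (dleft b c) = dleft a (dright b c)
}.

Notation "x ⊣ y" := (dleft x y) : dialgebra_scope.
Notation "x ⊢ y" := (dright x y) : dialgebra_scope.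

Section PATS.
Variable D : dialgebra.
Local Open Scope dialgebra_scope.

Definition pats (a b c : D) : D :=
  (a ⊣ b ⊣ c) - (a ⊣ c ⊣ b) - (b ⊢ a ⊣ c) + (c ⊢ a ⊣ b)
  + (b ⊢ c ⊢ a) - (c ⊢ b ⊢ a).

Let lincD (U : lmodType rat) (k : rat) (u u' v v' : U) :
  (k *: u + u') + (k *: v + v') = k *: (u + v) + (u' + v').
Proof. by rewrite scalerDr addrACA. Qed.

Let lincB (U : lmodType rat) (k : rat) (u u' v v' : U) :
  (k *: u + u') - (k *: v + v') = k *: (u - v) + (u' - v').
Proof. by rewrite opprD addrACA scalerBr. Qed.

Lemma pats_trilinear : trilinear pats.
Proof.
by split=> a b k u v; rewrite /pats; do ! rewrite ?(dleft_linear1, dleft_linear2,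
  dright_linear1, dright_linear2); rewrite !(lincB, lincD).
Qed.

Definition pats_algebra := TernaryAlgebra pats_trilinear.

Lemma pats_inner0 (s : D) :
  (forall a, a ⊣ s = 0) -> (forall a, s ⊢ a = 0) -> forall v z, pats v s z = 0.
Proof.
move=> l0 r0 v z; rewrite /pats !l0 !r0 [z ⊢ s ⊢ v]drightA r0.
rewrite (linear_at0 (dleft_linear1 _)) (linear_at0 (dright_linear1 _)).
by rewrite (linear_at0 (dright_linear2 _)) !(subr0, addr0).
Qed.

Let pats_inner_linear (f : D -> D) (w x y : D) : linear f ->
  (forall p q, f (p ⊣ q) = f (p ⊢ q)) ->
  (forall p q r, f (p ⊣ q ⊢ r) = f (p ⊢ q ⊢ r)) ->
  f (pats w x y + pats x w y) = 0.
Proof.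
move=> fL E B.
have fD u v : f (u + v) = f u + f v by have := fL 1 u v; rewrite !scale1r.
have fN u : f (- u) = - f u.
  by have := fL (-1) u 0; rewrite (linear_at0 fL) !addr0 !scaleN1r.
rewrite fD /pats !(fD, fN) !E !B.
by rewrite (AC (6*6) ((1*9)*(11*2)*(7*3)*(4*12)*(5*8)*(10*6))) /= !subrr !addr0.
Qed.

Lemma pats_isPATA : isPATA pats_algebra.
Proof.
split=> [x y z|v w x y z]; rewrite /tprod /=.
  rewrite /pats (AC (6*6) ((1*8)*(7*2)*(9*4)*(10*3)*(5*12)*(11*6))) /=.
  by rewrite ![- _ + _]addrC !subrr !addr0.
have [_ m2 _] := pats_trilinear.
have := m2 v z 1 (pats w x y) (pats x w y); rewrite !scale1r => <-.
apply: pats_inner0 => a.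
  apply: (@pats_inner_linear (dleft a)).
  - exact: dleft_linear2.
  - by move=> p q; exact: dleft_bar.
  - by move=> p q r; rewrite dright_bar.
apply: (@pats_inner_linear (fun s => s ⊢ a)).
- exact: dright_linear1.
- by move=> p q; exact: dright_bar.
- by move=> p q r; rewrite dright_bar.
Qed.

End PATS.

(* h ≡ 0 is satisfied by the PATS.                                            *)
Definition satisfied_by_PATS (X : choiceType) (h : freePATA X) :=
  forall (D : dialgebra) (x : X -> pats_algebra D), PATA_eval x h = 0.

Section BilinearExtension.
Variable K : choiceType.
Implicit Types (m : K -> K -> K) (u v w : {malg rat[K]}).

Definition bilin_ext m u v : {malg rat[K]} :=
  lin_ext (fun s => lin_ext (fun t => << m s t >> : {malg rat[K]}) v) u.

Lemma bilin_ext_linear1 m v : linear (fun u => bilin_ext m u v).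
Proof. exact: lin_ext_is_linear. Qed.

Lemma bilin_ext_linear2 m u : linear (bilin_ext m u).
Proof. by move=> c v w; apply: lin_extP => s; exact: lin_ext_is_linear. Qed.

Lemma bilin_extU m s t : bilin_ext m << s >> << t >> = << m s t >>.
Proof. by rewrite /bilin_ext !lin_extU. Qed.

Let trilin_ext (m : K -> K -> K -> K) u v w : {malg rat[K]} :=
  lin_ext (fun s => lin_ext (fun t => lin_ext (fun r =>
    << m s t r >> : {malg rat[K]}) w) v) u.

Let bilin_extl m1 m2 u v w : bilin_ext m1 (bilin_ext m2 u v) w =
  trilin_ext (fun s t => m1 (m2 s t)) u v w.
Proof.
rewrite {2}/bilin_ext (lin_ext_comp _ _ (bilin_ext_linear1 _ _)).
apply: eq_lin_ext => s; rewrite (lin_ext_comp _ _ (bilin_ext_linear1 _ _)).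
by apply: eq_lin_ext => t; rewrite /bilin_ext lin_extU.
Qed.

Let bilin_extr m1 m2 u v w : bilin_ext m1 u (bilin_ext m2 v w) =
  trilin_ext (fun s t r => m1 s (m2 t r)) u v w.
Proof.
apply: eq_lin_ext => s; rewrite {1}/bilin_ext.
rewrite (lin_ext_comp _ _ (@lin_ext_is_linear _ _ _)); apply: eq_lin_ext => t.
rewrite (lin_ext_comp _ _ (@lin_ext_is_linear _ _ _)); apply: eq_lin_ext => r.
exact: lin_extU.
Qed.

Let eq_trilin_ext (m m' : K -> K -> K -> K) u v w : (forall s t r, m s t r = m' s t r) ->
  trilin_ext m u v w = trilin_ext m' u v w.
Proof.
move=> mm'; apply: eq_lin_ext => s; apply: eq_lin_ext => t.
by apply: eq_lin_ext => r; rewrite mm'.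
Qed.

Lemma bilin_ext_lr m1 m2 m3 m4 u v w :
  (forall s t r, m1 (m2 s t) r = m3 s (m4 t r)) ->
  bilin_ext m1 (bilin_ext m2 u v) w = bilin_ext m3 u (bilin_ext m4 v w).
Proof. by move=> mA; rewrite bilin_extl bilin_extr; exact: eq_trilin_ext. Qed.

Lemma bilin_ext_ll m1 m2 m3 m4 u v w :
  (forall s t r, m1 (m2 s t) r = m3 (m4 s t) r) ->
  bilin_ext m1 (bilin_ext m2 u v) w = bilin_ext m3 (bilin_ext m4 u v) w.
Proof. by move=> mA; rewrite !bilin_extl; exact: eq_trilin_ext. Qed.

Lemma bilin_ext_rr m1 m2 m3 m4 u v w :
  (forall s t r, m1 s (m2 t r) = m3 s (m4 t r)) ->
  bilin_ext m1 u (bilin_ext m2 v w) = bilin_ext m3 u (bilin_ext m4 v w).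
Proof. by move=> mA; rewrite !bilin_extr; exact: eq_trilin_ext. Qed.

End BilinearExtension.

Section FreeDialgebra.
Variable X : choiceType.

(* (l, c, r) is the word l c r with its letter c marked as the center.        *)
Definition dmon : choiceType := (seq X * X * seq X)%type.

Definition dmon_left (s t : dmon) : dmon :=
  let: (l, c, r) := s in let: (l', c', r') := t in (l, c, r ++ l' ++ c' :: r').
Definition dmon_right (s t : dmon) : dmon :=
  let: (l, c, r) := s in let: (l', c', r') := t in (l ++ c :: r ++ l', c', r').

Definition FD : lmodType rat := {malg rat[dmon]}.

Definition FD_left : FD -> FD -> FD := bilin_ext dmon_left.
Definition FD_right : FD -> FD -> FD := bilin_ext dmon_right.

Lemma dmon_leftA s t r :
  dmon_left (dmon_left s t) r = dmon_left s (dmon_left t r).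
Proof. by case: s t r => [[? ?] ?] [[? ?] ?] [[? ?] ?] /=; rewrite -!catA. Qed.

Lemma dmon_rightA s t r :
  dmon_right (dmon_right s t) r = dmon_right s (dmon_right t r).
Proof.
by case: s t r => [[? ?] ?] [[? ?] ?] [[? ?] ?] /=; rewrite -!catA /= -!catA.
Qed.

Lemma dmon_innerA s t r :
  dmon_left (dmon_right s t) r = dmon_right s (dmon_left t r).
Proof. by case: s t r => [[? ?] ?] [[? ?] ?] [[? ?] ?]. Qed.

Lemma dmon_right_bar s t r :
  dmon_right (dmon_left s t) r = dmon_right (dmon_right s t) r.
Proof.
by case: s t r => [[? ?] ?] [[? ?] ?] [[? ?] ?] /=; rewrite -!catA /= -!catA.
Qed.

Lemma dmon_left_bar s t r :
  dmon_left s (dmon_left t r) = dmon_left s (dmon_right t r).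
Proof.
by case: s t r => [[? ?] ?] [[? ?] ?] [[? ?] ?] /=; rewrite -!catA /= -!catA.
Qed.

Definition freeDialgebra : dialgebra := @Dialgebra FD FD_left FD_right
  (bilin_ext_linear1 _) (bilin_ext_linear2 _)
  (bilin_ext_linear1 _) (bilin_ext_linear2 _)
  (fun u v w => bilin_ext_lr u v w dmon_leftA)
  (fun u v w => bilin_ext_lr u v w dmon_rightA)
  (fun u v w => bilin_ext_lr u v w dmon_innerA)
  (fun u v w => bilin_ext_ll u v w dmon_right_bar)
  (fun u v w => bilin_ext_rr u v w dmon_left_bar).

Definition FD_gen (x : X) : freeDialgebra := << ([::], x, [::]) : dmon >>.

Section Universal.
Local Open Scope dialgebra_scope.
Variables (D : dialgebra) (x : X -> D).

Definition dmon_eval (s : dmon) : D :=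
  let: (l, c, r) := s in
  foldr (fun i p => x i ⊢ p) (foldl (fun p i => p ⊣ x i) (x c) r) l.

Definition FD_eval : freeDialgebra -> D := lin_ext dmon_eval.

Lemma FD_eval_is_linear : linear FD_eval.
Proof. exact: lin_ext_is_linear. Qed.

Lemma FD_eval_gen i : FD_eval (FD_gen i) = x i.
Proof. exact: lin_extU. Qed.

Let foldl_left (p q : D) r : p ⊣ foldl (fun p i => p ⊣ x i) q r =
  foldl (fun p i => p ⊣ x i) (p ⊣ q) r.
Proof. by elim: r q => //= i r IH q; rewrite IH dleftA. Qed.

Let foldr_left (p q : D) l : p ⊣ foldr (fun i p => x i ⊢ p) q l =
  foldl (fun p i => p ⊣ x i) p l ⊣ q.
Proof. by elim: l p => //= i l IH p; rewrite -dleft_bar -dleftA IH. Qed.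

Let foldl_right (p q : D) r : foldl (fun p i => p ⊣ x i) p r ⊢ q =
  p ⊢ foldr (fun i p => x i ⊢ p) q r.
Proof. by elim: r p => //= i r IH p; rewrite IH dright_bar drightA. Qed.

Let foldr_right (p q : D) l : foldr (fun i p => x i ⊢ p) p l ⊢ q =
  foldr (fun i p => x i ⊢ p) (p ⊢ q) l.
Proof. by elim: l => //= i l IH; rewrite drightA IH. Qed.

Let foldr_leftC (p q : D) l : foldr (fun i p => x i ⊢ p) p l ⊣ q =
  foldr (fun i p => x i ⊢ p) (p ⊣ q) l.
Proof. by elim: l => //= i l IH; rewrite dinnerA IH. Qed.

Lemma dmon_eval_left s t : dmon_eval (dmon_left s t) = dmon_eval s ⊣ dmon_eval t.
Proof.
case: s t => [[l c] r] [[l' c'] r'] /=.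
by rewrite foldr_leftC foldr_left foldl_left !foldl_cat.
Qed.

Lemma dmon_eval_right s t :
  dmon_eval (dmon_right s t) = dmon_eval s ⊢ dmon_eval t.
Proof.
case: s t => [[l c] r] [[l' c'] r'] /=.
by rewrite foldr_right foldl_right !foldr_cat /= foldr_cat.
Qed.

Let FD_eval_bilin m (M : D -> D -> D) :
  (forall q, linear (fun p => M p q)) -> (forall p, linear (M p)) ->
  (forall s t, dmon_eval (m s t) = M (dmon_eval s) (dmon_eval t)) ->
  forall u v, FD_eval (bilin_ext m u v) = M (FD_eval u) (FD_eval v).
Proof.
move=> M1 M2 mM u v; have L := FD_eval_is_linear.
rewrite /bilin_ext (lin_ext_comp _ _ L) [in RHS]/FD_eval (lin_ext_comp _ _ (M1 _)).
apply: eq_lin_ext => s; rewrite (lin_ext_comp _ _ L) (lin_ext_comp _ _ (M2 _)).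
by apply: eq_lin_ext => t; rewrite -mM; exact: lin_extU.
Qed.

Lemma FD_eval_left u v : FD_eval (u ⊣ v) = FD_eval u ⊣ FD_eval v.
Proof.
apply: FD_eval_bilin; [exact: dleft_linear1|exact: dleft_linear2|].
exact: dmon_eval_left.
Qed.

Lemma FD_eval_right u v : FD_eval (u ⊢ v) = FD_eval u ⊢ FD_eval v.
Proof.
apply: FD_eval_bilin; [exact: dright_linear1|exact: dright_linear2|].
exact: dmon_eval_right.
Qed.

End Universal.
End FreeDialgebra.

Section RowCanonicalForm.
Variables (F : fieldType) (m n : nat).
Implicit Types (A R : 'M[F]_(m, n)) (v : 'cV[F]_n).

Definition leading R (i : 'I_m) (j : 'I_n) :=
  (R i j != 0) && [forall k : 'I_n, (k < j)%N ==> (R i k == 0)].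

Definition is_rref R :=
  [/\ forall i i' : 'I_m, (i < i')%N -> row i R = 0 -> row i' R = 0,
      forall i j, leading R i j -> R i j = 1,
      forall (i i' : 'I_m) (j j' : 'I_n),
        leading R i j -> leading R i' j' -> (i < i')%N -> (j < j')%N
    & forall i i' j, leading R i j -> i' != i -> R i' j = 0].

Definition row_canonical_form A R :=
  is_rref R /\ exists2 P : 'M_m, P \in unitmx & R = P *m A.

Definition free_column R (j : 'I_n) := [forall i, ~~ leading R i j].

(* The solution of R v = 0 in which the free variable j is 1 and the other    *)
(* free variables are 0: see canonical_solutionP.                             *)
Definition canonical_solution R (j : 'I_n) : 'cV[F]_n :=
  \col_k (if k == j then 1 else - \sum_(i | leading R i k) R i j).

Lemma leadingP R i : row i R != 0 -> exists j, leading R i j.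
Proof.
case/rV0Pn => j0; rewrite mxE => Rj0.
case: (@arg_minnP _ j0 (fun j => R i j != 0) (@nat_of_ord n)) => // j Rj jmin.
exists j; rewrite /leading Rj; apply/forallP => k; apply/implyP.
by apply: contraLR => Rk; rewrite -leqNgt jmin.
Qed.

Lemma not_free_column R j : ~~ free_column R j -> exists i, leading R i j.
Proof. by case/forallPn => i; rewrite negbK; exists i. Qed.

Lemma rref_mul R i p v : is_rref R -> leading R i p ->
  (R *m v) i 0 = v p 0 + \sum_(k | free_column R k) R i k * v k 0.
Proof.
case=> _ R1 _ R0 ip; rewrite mxE (bigD1 p) //= R1 // mul1r; congr (_ + _).
rewrite [RHS]big_mkcond [LHS]big_mkcond /=; apply: eq_bigr => k _.
case: ifPn => [kp|/negbNE/eqP->]; last first.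
  by case: ifP => // /forallP/(_ i); rewrite ip.
case: ifPn => // /not_free_column[i' i'k].
rewrite (R0 _ _ _ i'k) ?mul0r //; apply: contraNneq kp => ii'; apply/eqP.
subst i'; have [kp|pk|/val_inj //] := ltngtP k p.
  by case/andP: ip => _ /forallP/(_ k); rewrite kp; case/andP: i'k => /negPf->.
by case/andP: i'k => _ /forallP/(_ p); rewrite pk; case/andP: ip => /negPf->.
Qed.

Lemma canonical_solutionP R j v : is_rref R -> free_column R j ->
  v = canonical_solution R j <->
  [/\ R *m v = 0, v j 0 = 1 & forall k, free_column R k -> k != j -> v k 0 = 0].
Proof.
move=> Rr jF.
have one (w : 'cV[F]_n) : (forall k, free_column R k -> k != j -> w k 0 = 0) -> w j 0 = 1 ->
    forall i p, leading R i p -> (R *m w) i 0 = w p 0 + R i j.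
  move=> w0 w1 i p ip; rewrite (rref_mul _ Rr ip) (bigD1 j) //= w1 mulr1.
  by rewrite big1 ?addr0 // => k /andP[kF kj]; rewrite w0 // mulr0.
have sol i p : leading R i p -> canonical_solution R j p 0 = - R i j.
  move=> ip; rewrite mxE; case: eqP => [pj|_].
    by move/forallP: jF => /(_ i); rewrite -pj ip.
  congr (- _); rewrite (bigD1 i) //= big1 ?addr0 // => i' /andP[i'p i'i].
  by case: Rr i'p => _ _ _ /(_ _ _ _ ip i'i) Ri' /andP[]; rewrite Ri' eqxx.
have sol0 k : free_column R k -> k != j -> canonical_solution R j k 0 = 0.
  move=> kF kj; rewrite mxE (negPf kj) big_pred0 ?oppr0 // => i.
  by move/forallP: kF => /(_ i)/negPf.
have sol1 : canonical_solution R j j 0 = 1 by rewrite mxE eqxx.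
split=> [->|[v0 v1 vF]].
  split=> //; apply/matrixP => i z; rewrite (ord1 z) [RHS]mxE.
  have [R0|/leadingP[p ip]] := eqVneq (row i R) 0.
    by rewrite mxE big1 // => k _; have /rowP/(_ k) := R0; rewrite !mxE => ->;
       rewrite mul0r.
  by rewrite (one _ sol0 sol1 _ _ ip) (sol _ _ ip) addNr.
apply/matrixP => k z; rewrite (ord1 z).
have [kF|/not_free_column[i ik]] := boolP (free_column R k).
  by have [->|kj] := eqVneq k j; [rewrite v1 sol1 | rewrite vF ?sol0].
rewrite (sol _ _ ik); apply/eqP; rewrite -addr_eq0 -(one v vF v1 _ _ ik).
by rewrite v0 mxE.
Qed.

Lemma free_columnE R j : is_rref R -> free_column R j <->
  exists v, [/\ R *m v = 0, v j 0 = 1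
    & forall k : 'I_n, (j < k)%N -> v k 0 = 0].
Proof.
move=> Rr; split=> [jF|[v [v0 v1 vk]]].
  exists (canonical_solution R j).
  have [/(_ erefl)[v0 v1 _] _] :=
    canonical_solutionP (canonical_solution R j) Rr jF.
  split=> // k jk; rewrite mxE; case: eqP => [kj|_].
    by rewrite kj ltnn in jk.
  rewrite big1 ?oppr0 // => i /andP[_ /forallP/(_ j)].
  by rewrite jk => /eqP.
apply/forallP => i; apply/negP => ij; have /matrixP/(_ i 0) := v0.
rewrite !mxE (bigD1 j) //= big1 => [|k kj].
  by case: Rr => _ /(_ _ _ ij)-> _ _; rewrite v1 mulr1 addr0 => /eqP;
     rewrite oner_eq0.
have [lt_kj|lt_jk|/val_inj kj'] := ltngtP k j; last by rewrite kj' eqxx in kj.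
  by case/andP: ij => _ /forallP/(_ k); rewrite lt_kj => /eqP->; rewrite mul0r.
by rewrite vk ?mulr0.
Qed.

Lemma row_canonical_form_unique A R R' :
  row_canonical_form A R -> row_canonical_form A R' ->
  free_column R =1 free_column R' /\
  forall j, free_column R j -> canonical_solution R j = canonical_solution R' j.
Proof.
case=> Rr [P Pu RE] [Rr' [Q Qu RE']].
have ker (v : 'cV[F]_n) : R *m v = 0 <-> R' *m v = 0.
  rewrite RE RE' -!mulmxA; split=> /(canRL (mulKmx _))->; rewrite ?mulmx0 //.
have FE : free_column R =1 free_column R'.
  move=> j; apply/idP/idP => /free_columnE-/(_ _)[] // v [v0 v1 vk];
  by apply/free_columnE => //; exists v; split=> //; apply/ker.
split=> // j jF; have [/(_ erefl)[v0 v1 vk] _] :=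
  canonical_solutionP (canonical_solution R j) Rr jF.
apply/(canonical_solutionP _ Rr'); rewrite -?FE //.
by split=> //; [apply/ker | move=> k; rewrite -FE; exact: vk].
Qed.

End RowCanonicalForm.

Definition is_basis (U : lmodType rat) (W : U -> Prop) (s : seq U) :=
  (forall c : 'I_(size s) -> rat,
     \sum_i c i *: s`_i = 0 -> forall i, c i = 0) /\
  (forall h, W h <-> exists c : 'I_(size s) -> rat, h = \sum_i c i *: s`_i).

Definition has_dim (U : lmodType rat) (W : U -> Prop) (d : nat) :=
  exists2 s, is_basis W s & size s = d.

Notation letter := 'I_6.

Definition la : letter := @Ordinal 6 0 isT.
Definition lb : letter := @Ordinal 6 1 isT.
Definition lc : letter := @Ordinal 6 2 isT.
Definition ld : letter := @Ordinal 6 3 isT.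
Definition le : letter := @Ordinal 6 4 isT.
Definition lf : letter := @Ordinal 6 5 isT.

Definition content211111 : seq letter := [:: la; la; lb; lc; ld; le; lf].

Definition V211111 (h : freePATA letter) :=
  exists2 u : freeTernary letter,
    forall t, t \in msupp u -> perm_eq (tleaves t) content211111
  & h = pata_pi u.

Definition N211111 (h : freePATA letter) := V211111 h /\ satisfied_by_PATS h.

Definition lex_le (u v : seq letter) := ((u : seqlexi letter) <= v)%O.
Definition lex_lt (u v : seq letter) := ((u : seqlexi letter) < v)%O.

Definition words211111 : seq (seq letter) :=
  sort lex_le (permutations content211111).

Local Notation "⟨ x , y , z ⟩" := (TNode x y z).

(* The monomial of association type k in the variables w, if straightened.    *)
Definition straightened (k : nat) (w : seq letter) : option (tmon letter) :=
  if w is [:: x1; x2; x3; x4; x5; x6; x7] then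
    let v := @TVar letter in
    match k with
    | 1 => if [&& x2 < x3, x4 < x5 & x6 < x7]%N then
        Some ⟨⟨⟨v x1, v x2, v x3⟩, v x4, v x5⟩, v x6, v x7⟩ else None
    | 2 => if [&& x2 < x3, x3 < x4 & x6 < x7]%N then
        Some ⟨⟨v x1, ⟨v x2, v x3, v x4⟩, v x5⟩, v x6, v x7⟩ else None
    | 3 => if [&& x2 < x3, x4 < x5 & x5 < x6]%N then
        Some ⟨⟨v x1, v x2, v x3⟩, ⟨v x4, v x5, v x6⟩, v x7⟩ else None
    | 4 => if [&& x2 < x3, x3 < x4 & x5 < x6]%N then
        Some ⟨v x1, ⟨⟨v x2, v x3, v x4⟩, v x5, v x6⟩, v x7⟩ else None
    | 5 => if [&& x2 < x3, x3 < x4, x5 < x6 & x6 < x7]%N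
              && lex_lt [:: x2; x3; x4] [:: x5; x6; x7] then
        Some ⟨v x1, ⟨v x2, v x3, v x4⟩, ⟨v x5, v x6, v x7⟩⟩ else None
    | _ => None
    end
  else None.

Definition smons211111 : seq (tmon letter) :=
  flatten [seq pmap (straightened k) words211111 | k <- [:: 1; 2; 3; 4; 5]].

Definition smon211111 (j : 'I_(size smons211111)) : tmon letter :=
  nth (TVar la) smons211111 j.

Definition lin_comb (v : 'cV[rat]_(size smons211111)) : freePATA letter :=
  \sum_j v j 0 *: PATA_mon (smon211111 j).

(* The coordinates of h in the basis of straightened monomials of V211111.    *)
Definition coords (h : freePATA letter) : 'cV[rat]_(size smons211111) :=
  xget 0 [set v | h = lin_comb v]%classic.

Definition nterms (h : freePATA letter) : nat :=
  #|[set j | coords h j 0 != 0]%SET|.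

(* The monomials of the free dialgebra which occur in the expansions.         *)
Definition dmons211111 : seq (dmon letter) :=
  [seq (take i w, nth la w i, drop i.+1 w) | w <- words211111, i <- iota 0 7].

Definition expansion (t : tmon letter) : freeDialgebra letter :=
  tmon_eval (A := pats_algebra (freeDialgebra letter)) (@FD_gen letter) t.

Definition E211111 : 'M[rat]_(size dmons211111, size smons211111) :=
  \matrix_(i, j)
    (expansion (smon211111 j) : FD letter)@_(nth ([::], la, [::]) dmons211111 i).

(* R is to be the row canonical form of E211111; by row_canonical_form_unique *)
(* the result depends on the matrix E211111 only.                             *)
Definition canonical_basis (R : 'M[rat]_(size dmons211111, size smons211111)) :
    seq (freePATA letter) :=
  [seq lin_comb (canonical_solution R j) | j <- enum (free_column R)].

Local Notation "[: x , y , z ]" := (tprod x y z).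

Definition I211111_b : freePATA letter :=
  let x := @PATA_gen letter in
  let alt (m : 'S_6 -> freePATA letter) :=
    \sum_(s : 'S_6 | s lb == lb) (-1) ^+ s *: m s in
    4^-1 *: alt (fun s =>
      [: [: [: x lb, x (s la), x (s lc)], x la, x (s ld)], x (s le), x (s lf)])
  - 12^-1 *: alt (fun s =>
      [: [: x lb, [: x (s la), x (s lc), x (s ld)], x la], x (s le), x (s lf)])
  - 12^-1 *: alt (fun s =>
      [: [: x lb, x (s la), x (s lc)], [: x (s ld), x (s le), x (s lf)], x la])
  - 6^-1 *: alt (fun s =>
      [: x lb, [: [: x (s la), x (s lc), x (s ld)], x la, x (s le)], x (s lf)]).

(* Interchanging the letters y and z in h.                                    *)
Definition interchange (y z : letter) (h : freePATA letter) : freePATA letter :=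
  PATA_eval (fun i => PATA_gen (tperm y z i)) h.

(* x = b, c, d, e, f give the five identities.                                *)
Definition I211111 (x : letter) : freePATA letter := interchange lb x I211111_b.

(* Main.v *)
(* Straightening shows that normal monomials span the free PATA, and they are *)
(* independent because they evaluate to distinct basis vectors in a PATA      *)
(* whose product straightens its last two factors.  So N is the nullspace of  *)
(* the expansion matrix E.  Twelve explicit vectors are checked to lie in it; *)
(* each is 1 at its last nonzero coordinate and 0 at that of the others.      *)
(* Integer elimination on 793 of the 17640 rows of E shows that a vector of   *)
(* the nullspace that vanishes at those twelve coordinates is zero.  Hence    *)
(* the twelve coordinates are the free columns, and the twelve vectors the    *)
(* canonical basis; counting nonzero coordinates leaves five vectors, which   *)
(* are compared with the straightened 480 terms of 12 I^(x).                  *)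

Require Import Defs.
From Stdlib Require Import ZArith FMapPositive.
From mathcomp Require Import all_boot all_order all_fingroup all_algebra finmap.
From mathcomp Require Import boolp classical_sets monalg ssrZ zify ring.

Set Implicit Arguments.
Unset Strict Implicit.
Unset Printing Implicit Defensive.

Import Order.TTheory GRing.Theory Num.Theory.
Local Open Scope ring_scope.

(** * Signed sums *)

(** In a PATA, a product standing in the second or third place of another product alternates in all
    three of its factors: the two identities supply the two adjacent transpositions. Its first
    factor can therefore also be moved to a second place, and alternation spreads to every product
    nested inside. Only the products on the leftmost path of a monomial are left with alternation in
    their last two factors alone. Sorting accordingly writes each monomial through normal ones
    ([tmon_eval_nf]). The normal monomials are independent because sorting itself defines a PATA in
    which each of them evaluates to itself ([NF_algebra_isPATA], [normal_mon_free]). For the content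
    of the theorem they are exactly the 805 straightened monomials ([top_normal_smons]).

    Every evaluation in a dialgebra factors through the free dialgebra ([tmon_eval_pats]), so N is
    the nullspace of E ([N211111P]). The PATS keeps the center of its first factor, hence a monomial
    expands into words centered at its leftmost letter, and E splits into a block of 280 columns for
    a and five blocks of 105 columns for b, c, d, e, f. Their nullities are 7 and 1, 1, 1, 1, 1.

    The nullspace is certified from both sides. Twelve given integer vectors are annihilated by
    every row of E ([kernel_vec_satisfied]). Conversely, rows obtained from E by elimination are
    combinations of rows of E, so a nullspace vector annihilates them; their final echelon shape
    then forces a nullspace vector that vanishes at twelve chosen columns to be zero
    ([back_substitution], [kernel_pivots_determine]). Since each given vector is 1 at its own chosen
    column, 0 at the others and 0 further on, the row canonical form can be written down from them,
    and they are its canonical solutions ([row_canonical_form_kernel]). The five vectors with 60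
    terms are those of the blocks b to f; straightening the alternating sums identifies them with
    the stated identities ([kernel_vec_I211111]). *)

Section SignedSum.
Variable U : lmodType rat.

(** Signed lists of monomials keep straightening and expansion computable; [F] interprets them in a
    module. *)
Definition signed_sum (T : Type) (F : T -> U) (s : seq (bool * T)) : U :=
  \sum_(x <- s) (-1) ^+ x.1 *: F x.2.

Lemma signed_sum_nil (T : Type) (F : T -> U) : signed_sum F [::] = 0.
Proof. by rewrite /signed_sum big_nil. Qed.

Lemma signed_sum1 (T : Type) (F : T -> U) b x :
  signed_sum F [:: (b, x)] = (-1) ^+ b *: F x.
Proof. by rewrite /signed_sum big_seq1. Qed.

Lemma signed_sum_cons (T : Type) (F : T -> U) b x s :
  signed_sum F ((b, x) :: s) = (-1) ^+ b *: F x + signed_sum F s.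
Proof. by rewrite /signed_sum big_cons. Qed.

Lemma signed_sum_cat (T : Type) (F : T -> U) s1 s2 :
  signed_sum F (s1 ++ s2) = signed_sum F s1 + signed_sum F s2.
Proof. by rewrite /signed_sum big_cat. Qed.

Lemma eq_signed_sum (T : Type) (F G : T -> U) s :
  F =1 G -> signed_sum F s = signed_sum G s.
Proof. by move=> FG; apply: eq_bigr => x _; rewrite FG. Qed.

Lemma eq_signed_sum_in (T : eqType) (F G : T -> U) s :
  {in s, forall x, F x.2 = G x.2} -> signed_sum F s = signed_sum G s.
Proof. by move=> FG; apply: eq_big_seq => x /FG->. Qed.

Lemma signed_sum_opp (T : Type) (F : T -> U) s :
  signed_sum (fun x => - F x) s = - signed_sum F s.
Proof. by rewrite /signed_sum -sumrN; apply: eq_bigr => x _; rewrite scalerN. Qed.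

Lemma signed_sum_exchange (T1 T2 : Type) (F : T1 -> T2 -> U) s1 s2 :
  signed_sum (fun a => signed_sum (F a) s2) s1 =
  signed_sum (fun b => signed_sum (F^~ b) s1) s2.
Proof.
rewrite /signed_sum; under eq_bigr => a _ do rewrite scaler_sumr.
rewrite exchange_big; apply: eq_bigr => b _; rewrite scaler_sumr.
by apply: eq_bigr => a _; rewrite !scalerA mulrC.
Qed.

Definition flip (T : Type) (e : bool) (s : seq (bool * T)) : seq (bool * T) :=
  [seq (e (+) x.1, x.2) | x <- s].

Lemma signed_sum_flip (T : Type) (F : T -> U) e s :
  signed_sum F (flip e s) = (-1) ^+ e *: signed_sum F s.
Proof.
rewrite /signed_sum big_map scaler_sumr; apply: eq_bigr => x _.
by rewrite scalerA -signr_addb.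
Qed.

(** The trilinear extension of [f] from monomials to signed lists. *)
Definition prod3 (T1 T2 T3 T : Type) (f : T1 -> T2 -> T3 -> seq (bool * T))
    s1 s2 s3 : seq (bool * T) :=
  flatten [seq flatten [seq flatten
    [seq flip (a.1 (+) (b.1 (+) c.1)) (f a.2 b.2 c.2) | c <- s3]
    | b <- s2] | a <- s1].

Lemma signed_sum_flatten (T : Type) (F : T -> U) ss :
  signed_sum F (flatten ss) = \sum_(s <- ss) signed_sum F s.
Proof.
elim: ss => [|s ss IH] /=; first by rewrite big_nil signed_sum_nil.
by rewrite big_cons signed_sum_cat IH.
Qed.

Lemma signed_sum_prod3 (T1 T2 T3 T : Type) (F : T -> U)
    (f : T1 -> T2 -> T3 -> seq (bool * T)) s1 s2 s3 :
  signed_sum F (prod3 f s1 s2 s3) =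
  signed_sum (fun a => signed_sum (fun b =>
    signed_sum (fun c => signed_sum F (f a b c)) s3) s2) s1.
Proof.
rewrite signed_sum_flatten big_map; apply: eq_bigr => a _.
rewrite signed_sum_flatten big_map scaler_sumr; apply: eq_bigr => b _.
rewrite signed_sum_flatten big_map !scaler_sumr; apply: eq_bigr => c _.
by rewrite signed_sum_flip !scalerA !signr_addb mulrA.
Qed.
End SignedSum.

Lemma mem_prod3 (T1 T2 T3 T : eqType) (f : T1 -> T2 -> T3 -> seq (bool * T))
    s1 s2 s3 x : x \in prod3 f s1 s2 s3 ->
  exists a b c e, [/\ a \in s1, b \in s2, c \in s3 & (e, x.2) \in f a.2 b.2 c.2].
Proof.
case/flattenP => _ /mapP[a sa ->] /flattenP[_ /mapP[b sb ->]].
case/flattenP => _ /mapP[c sc ->] /mapP[y fy ->] /=.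
by exists a, b, c, y.1; split=> //; case: y fy.
Qed.

(** * Linear maps on sums and on spaces of monomials *)

Lemma linear_signed_sum (U V : lmodType rat) (f : U -> V) (T : Type)
    (F : T -> U) s :
  linear f -> f (signed_sum F s) = signed_sum (fun x => f (F x)) s.
Proof.
move=> fL; rewrite /signed_sum; elim/big_rec2: _ => [|x y z _ <-].
  exact: linear_at0.
by rewrite fL.
Qed.

Lemma linearZ_at (U V : lmodType rat) (f : U -> V) c u :
  linear f -> f (c *: u) = c *: f u.
Proof. by move=> fL; have := fL c u 0; rewrite !addr0 (linear_at0 fL) addr0. Qed.

Lemma linear_sumZ (U V : lmodType rat) (f : U -> V) (I : Type) (r : seq I)
    (c : I -> rat) (F : I -> U) : linear f ->
  f (\sum_(i <- r) c i *: F i) = \sum_(i <- r) c i *: f (F i).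
Proof.
move=> fL; elim/big_rec2: _ => [|i u v _ <-]; first exact: linear_at0.
by rewrite fL.
Qed.

Lemma sum_delta (U : lmodType rat) (n : nat) (j0 : 'I_n) (z : rat) (F : 'I_n -> U) :
  \sum_j (if j == j0 then z else 0) *: F j = z *: F j0.
Proof.
rewrite (bigD1 j0) //= eqxx big1 ?addr0 // => j /negPf->.
by rewrite scale0r.
Qed.

Lemma malgUZ (K : choiceType) (k : K) (c : rat) :
  << c *g k >> = c *: << k >> :> {malg rat[K]}.
Proof. by apply/malgP => j; rewrite mcoeffZ !mcoeffU mulr_natr. Qed.

Lemma mcoeff_sumZ (K : choiceType) (I : finType) (c : I -> rat)
    (f : I -> {malg rat[K]}) k :
  (\sum_i c i *: f i)@_k = \sum_i c i * (f i)@_k.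
Proof. by rewrite raddf_sum; apply: eq_bigr => i _; exact: mcoeffZ. Qed.

Lemma msupp_sumU (K : choiceType) (I : finType) (c : I -> rat) (f : I -> K) k :
  k \in msupp (\sum_i c i *: << f i >> : {malg rat[K]}) -> exists i, k = f i.
Proof.
rewrite -mcoeff_neq0 raddf_sum => nz; suff /existsP[i /eqP] : [exists i, k == f i].
  by exists i.
apply: contraNT nz => /existsPn kf; rewrite big1 // => i _.
by rewrite /= mcoeffZ mcoeffU eq_sym (negPf (kf i)) mulr0.
Qed.

Lemma linear_malg_eq0 (K : choiceType) (U : lmodType rat)
    (f : {malg rat[K]} -> U) :
  linear f -> (forall k, f << k >> = 0) -> forall u, f u = 0.
Proof.
move=> fL f0 u; rewrite [u]monalgE.
elim/big_rec: _ => [|k x _ IH]; first exact: linear_at0.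
by rewrite malgUZ fL f0 IH scaler0 addr0.
Qed.

(** Both identities are multilinear, so [linear_malg_eq0] replaces one argument after the other by a
    basis element. *)
Lemma isPATA_basis (K : choiceType) (m : {malg rat[K]} -> _ -> _ -> {malg rat[K]})
    (m3 : trilinear m) :
  (forall s t r, m << s >> << t >> << r >> + m << s >> << r >> << t >> = 0) ->
  (forall s a b c r,
     m << s >> (m << a >> << b >> << c >>) << r >> +
     m << s >> (m << b >> << a >> << c >>) << r >> = 0) ->
  isPATA (TernaryAlgebra m3).
Proof.
case: (m3) => n1 n2 n3 H1 H2.
split=> [u v w|u v w p q]; rewrite /tprod /=.
- move: w; apply: linear_malg_eq0 => [k y z|r].
    by rewrite n3 n2 scalerDr addrACA.
  move: v; apply: linear_malg_eq0 => [k y z|t].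
    by rewrite n3 n2 scalerDr addrACA.
  move: u; apply: linear_malg_eq0 => [k y z|s]; last exact: H1.
  by rewrite !n1 scalerDr addrACA.
- move: u; apply: linear_malg_eq0 => [k y z|s].
    by rewrite !n1 scalerDr addrACA.
  move: v; apply: linear_malg_eq0 => [k y z|a].
    by rewrite n1 !n2 scalerDr addrACA.
  move: w; apply: linear_malg_eq0 => [k y z|b].
    by rewrite n1 !n2 scalerDr addrACA.
  move: p; apply: linear_malg_eq0 => [k y z|c].
    by rewrite !n3 !n2 scalerDr addrACA.
  move: q; apply: linear_malg_eq0 => [k y z|r]; last exact: H2.
  by rewrite !n3 scalerDr addrACA.
Qed.

(** Since 2 is invertible, a product with two equal alternating factors vanishes. *)
Lemma eqN0 (U : lmodType rat) (u : U) : u = - u -> u = 0.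
Proof.
move/eqP; rewrite -addr_eq0 -mulr2n -scaler_nat scaler_eq0 pnatr_eq0 /=.
by move/eqP.
Qed.

(** * Normal forms in the free PATA *)

Section NormalForm.
Variables (X : choiceType) (disp : Order.disp_t) (K : orderType disp).
Variable key : tmon X -> K.
Local Open Scope order_scope.
Implicit Types (a b c s t r : tmon X).

Definition sort2 s a b : seq (bool * tmon X) :=
  if key a < key b then [:: (false, TNode s a b)]
  else if key b < key a then [:: (true, TNode s b a)] else [::].

(* For a < b only. *)
Definition insert3 a b c : seq (bool * tmon X) :=
  if key b < key c then [:: (false, TNode a b c)]
  else if key c < key b then
    if key a < key c then [:: (true, TNode a c b)]
    else if key c < key a then [:: (false, TNode c a b)] else [::]
  else [::].

Definition sort3 a b c : seq (bool * tmon X) :=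
  if key a < key b then insert3 a b c
  else if key b < key a then flip true (insert3 b a c) else [::].

(** Straightens a monomial in the second or third place of a product. It alternates there in its
    three factors, so each of them, the first included, can be brought to a second place and is
    straightened in the same way. *)
Fixpoint inner_nf t : seq (bool * tmon X) :=
  if t is TNode a b c then
    prod3 sort3 (inner_nf a) (inner_nf b) (inner_nf c)
  else [:: (false, t)].

Fixpoint nf t : seq (bool * tmon X) :=
  if t is TNode a b c then prod3 sort2 (nf a) (inner_nf b) (inner_nf c)
  else [:: (false, t)].

Section Alternating.
Variables (U : lmodType rat).

Lemma sort2_alt (F : tmon X -> U) s a b :
  signed_sum F (sort2 s a b) = - signed_sum F (sort2 s b a).
Proof.
rewrite /sort2; case: ltgtP => _;
  by rewrite ?signed_sum1 ?signed_sum_nil ?scaleN1r ?scale1r ?opprK ?oppr0.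
Qed.

Lemma sort3_alt12 (F : tmon X -> U) a b c :
  signed_sum F (sort3 a b c) = - signed_sum F (sort3 b a c).
Proof.
rewrite /sort3; case: ltgtP => _;
  by rewrite ?signed_sum_flip ?signed_sum_nil ?scaleN1r ?opprK ?oppr0.
Qed.

Lemma sort3_alt23 (F : tmon X -> U) a b c :
  signed_sum F (sort3 a b c) = - signed_sum F (sort3 a c b).
Proof.
have C (x y : K) : x < y -> y < x -> False by move=> /lt_trans h /h; rewrite ltxx.
rewrite /sort3 /insert3.
case: (ltgtP (key a) (key b)) => ab; case: (ltgtP (key a) (key c)) => ac;
  case: (ltgtP (key b) (key c)) => bc;
  rewrite ?signed_sum_flip ?signed_sum1 ?signed_sum_nil ?scaleN1r ?scale1r
    ?opprK ?oppr0 //; exfalso;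
  move: ab ac bc => /= ab ac bc.
all: try by move: (lt_trans ab bc) => /C; apply.
all: try by move: (lt_trans ac bc) => /C; apply.
all: try by move: (lt_trans bc ab) => /C; apply.
all: try by move: (lt_trans bc ac) => /C; apply.
all: try by move: ab ac; rewrite bc => /C; apply.
all: try by move: ac bc; rewrite ab => /C; apply.
all: by move: ab bc; rewrite ac => /C; apply.
Qed.
End Alternating.

Fixpoint inner_normal t : bool :=
  if t is TNode a b c then
    [&& inner_normal a, inner_normal b, inner_normal c,
        key a < key b & key b < key c]
  else true.

Fixpoint top_normal t : bool :=
  if t is TNode a b c then
    [&& top_normal a, inner_normal b, inner_normal c & key b < key c]
  else true.

Lemma mem_sort2 s a b e t : (e, t) \in sort2 s a b ->
  exists a' b', [/\ t = TNode s a' b', key a' < key b'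
    & (a', b') = (a, b) \/ (a', b') = (b, a)].
Proof.
rewrite /sort2; case: ltgtP => // ab; rewrite inE => /eqP[_ ->].
  by exists a, b; split; auto.
by exists b, a; split; auto.
Qed.

Lemma mem_sort3 a b c e t : (e, t) \in sort3 a b c ->
  exists a' b' c', [/\ t = TNode a' b' c', key a' < key b', key b' < key c'
    & perm_eq [:: a'; b'; c'] [:: a; b; c]].
Proof.
have insertP a' b' : key a' < key b' -> (e, t) \in insert3 a' b' c \/
    (e, t) \in flip true (insert3 a' b' c) ->
    exists a'' b'' c'', [/\ t = TNode a'' b'' c'', key a'' < key b'',
      key b'' < key c'' & perm_eq [:: a''; b''; c''] [:: a'; b'; c]].
  move=> ab'; rewrite /insert3; case: ltgtP => [bc|cb|_]; last by case.
    move=> H; exists a', b', c; split=> //.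
    by case: H; rewrite inE => /eqP[].
  case: ltgtP => [ac|ca|_]; last by case.
    move=> H; exists a', c, b'; split=> //; first by case: H; rewrite inE => /eqP[].
    by rewrite perm_cons; apply/seq.permP => p /=; lia.
  move=> H; exists c, a', b'; split=> //; first by case: H; rewrite inE => /eqP[].
  by apply/seq.permP => p /=; lia.
rewrite /sort3; case: ltgtP => // ab H.
  by apply: insertP => //; left.
have [|a' [b' [c' [-> ab' bc' p]]]] := insertP _ _ ab; first by right.
exists a', b', c'; split=> //; apply: perm_trans p _.
by apply/seq.permP => p /=; lia.
Qed.

Lemma inner_nf_normal t x : x \in inner_nf t -> inner_normal x.2.
Proof.
elim: t x => [y|a IHa b IHb c IHc] x /=; first by rewrite inE => /eqP->.
case/mem_prod3=> u [v [w [e [/IHa Nu /IHb Nv /IHc Nw]]]] /mem_sort3.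
case=> a' [b' [c' [-> ab bc /perm_mem p]]] /=; rewrite ab bc.
have N z : z \in [:: a'; b'; c'] -> inner_normal z.
  by rewrite p !inE => /or3P[] /eqP->.
by rewrite !N // !inE eqxx ?orbT.
Qed.

Lemma inner_nfE t : inner_normal t -> inner_nf t = [:: (false, t)].
Proof.
elim: t => //= a IHa b IHb c IHc /and5P[/IHa-> /IHb-> /IHc-> ab bc].
by rewrite /prod3 /= /sort3 /insert3 ab bc.
Qed.

Lemma inner_nf_leaves t x : x \in inner_nf t -> perm_eq (tleaves x.2) (tleaves t).
Proof.
elim: t x => [y|a IHa b IHb c IHc] x /=; first by rewrite inE => /eqP->.
case/mem_prod3=> u [v [w [e [/IHa Lu /IHb Lv /IHc Lw]]]] /mem_sort3.
case=> a' [b' [c' [-> _ _ p]]] /=.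
have := perm_flatten (perm_map (@tleaves X) p).
by rewrite /= !cats0 => /perm_trans->//; rewrite !perm_cat.
Qed.

Lemma nf_normal t x : x \in nf t -> top_normal x.2.
Proof.
elim: t x => [y|a IHa b IHb c IHc] x /=; first by rewrite inE => /eqP->.
case/mem_prod3=> u [v [w [e [/IHa Nu]]]].
move=> /inner_nf_normal Nv /inner_nf_normal Nw /mem_sort2.
by case=> b' [c' [-> bc []]] /= [E1 E2]; rewrite Nu bc E1 E2 Nv Nw.
Qed.

Lemma nf_leaves t x : x \in nf t -> perm_eq (tleaves x.2) (tleaves t).
Proof.
elim: t x => [y|a IHa b IHb c IHc] x /=; first by rewrite inE => /eqP->.
case/mem_prod3=> u [v [w [e [/IHa Lu]]]].
move=> /inner_nf_leaves Lv /inner_nf_leaves Lw /mem_sort2.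
case=> b' [c' [-> _ [] [-> ->]]] /=; first by rewrite !perm_cat.
by rewrite perm_cat // perm_catC perm_cat.
Qed.

Hypothesis key_inj : injective key.

Lemma sort2E (U : lmodType rat) (F : tmon X -> U) s a b :
  (forall a b, F (TNode s a b) = - F (TNode s b a)) ->
  signed_sum F (sort2 s a b) = F (TNode s a b).
Proof.
move=> F2; rewrite /sort2; case: ltgtP => [_|_|/key_inj->].
- by rewrite signed_sum1 scale1r.
- by rewrite signed_sum1 scaleN1r -F2.
- by rewrite signed_sum_nil [RHS]eqN0.
Qed.

Lemma sort3E (U : lmodType rat) (F : tmon X -> U) a b c :
  (forall a b c, F (TNode a b c) = - F (TNode b a c)) ->
  (forall a b c, F (TNode a b c) = - F (TNode a c b)) ->
  signed_sum F (sort3 a b c) = F (TNode a b c).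
Proof.
move=> F12 F23.
have insertE a' b' : signed_sum F (insert3 a' b' c) = F (TNode a' b' c).
  rewrite /insert3; case: ltgtP => [_|_|/key_inj->].
  - by rewrite signed_sum1 scale1r.
  - rewrite F23; case: ltgtP => [_|_|/key_inj->].
    + by rewrite signed_sum1 scaleN1r.
    + by rewrite signed_sum1 scale1r (F12 a') opprK.
    + by rewrite signed_sum_nil [F _]eqN0 ?oppr0.
  - by rewrite signed_sum_nil [RHS]eqN0.
rewrite /sort3; case: ltgtP => [_|_|/key_inj->].
- exact: insertE.
- by rewrite signed_sum_flip insertE scaleN1r -F12.
- by rewrite signed_sum_nil [RHS]eqN0.
Qed.

Section Straightening.
Variables (A : ternaryAlgebra) (x : X -> A).
Hypothesis APATA : isPATA A.
Let ev := tmon_eval x.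

Lemma tprod_alt23 (u v w : A) : tprod u v w = - tprod u w v.
Proof. by apply/eqP; rewrite -addr_eq0 APATA.1. Qed.

Lemma tprod_inner_nf t u w : tprod u (ev t) w =
  signed_sum (fun t' => tprod u (ev t') w) (inner_nf t).
Proof.
have [_ n2 _] := tprod_trilinear A.
have N (p q r : A) : tprod p (- q) r = - tprod p q r.
  by have := n2 p r (-1) q 0; rewrite !(linear_at0 (n2 _ _)) !addr0 !scaleN1r.
elim: t u w => [y|a IHa b IHb c IHc] u w /=; first by rewrite signed_sum1 scale1r.
pose M (p q r : A) := tprod u (tprod p q r) w.
have M12 (p q r : A) : M p q r = - M q p r.
  by apply/eqP; rewrite -addr_eq0 /M APATA.2.
have M23 (p q r : A) : M p q r = - M p r q by rewrite /M (tprod_alt23 p q r) N.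
have IH2 t (p r : A) : (forall u w, tprod u (ev t) w =
      signed_sum (fun t' => tprod u (ev t') w) (inner_nf t)) ->
    M p (ev t) r = signed_sum (fun t' => M p (ev t') r) (inner_nf t).
  by move=> IH; rewrite /M IH (linear_signed_sum _ _ (n2 _ _)).
rewrite -[LHS]/(M (ev a) (ev b) (ev c)) signed_sum_prod3.
(* The first factor is swapped into the second place, straightened there and swapped back; the third
   is treated likewise below. *)
rewrite M12 IH2 // -signed_sum_opp; apply: eq_signed_sum => a'.
rewrite -M12 IH2 //; apply: eq_signed_sum => b'.
rewrite M23 IH2 // -signed_sum_opp; apply: eq_signed_sum => c'.
by rewrite -M23 sort3E // => *; [exact: M12 | exact: M23].
Qed.

Lemma tmon_eval_nf t : ev t = signed_sum ev (nf t).
Proof.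
have [n1 _ _] := tprod_trilinear A.
elim: t => [y|a IHa b _ c _] /=; first by rewrite signed_sum1 scale1r.
rewrite -[LHS]/(tprod (ev a) (ev b) (ev c)) signed_sum_prod3 IHa (linear_signed_sum _ _ (n1 _ _)).
apply: eq_signed_sum => a'; rewrite tprod_inner_nf; apply: eq_signed_sum => b'.
rewrite tprod_alt23 tprod_inner_nf -signed_sum_opp; apply: eq_signed_sum => c'.
by rewrite -tprod_alt23 sort2E // => *; exact: tprod_alt23.
Qed.
End Straightening.

(* The space spanned by all monomials, with the product that straightens its  *)
(* last two factors, is a PATA in which normal monomials evaluate to          *)
(* themselves; this is why they are independent in the free PATA.             *)
Section NormalAlgebra.
Let mon t : FT X := << t >>.

Definition nmul s t r := prod3 sort2 [:: (false, s)] (inner_nf t) (inner_nf r).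

Definition NF_prod (u v w : FT X) : FT X :=
  lin_ext (fun s => lin_ext (fun t => lin_ext (fun r =>
    signed_sum mon (nmul s t r)) w) v) u.

Lemma NF_prod_trilinear : trilinear NF_prod.
Proof.
split=> [v w|u w|u v] k y z; rewrite /NF_prod.
- exact: linearP.
- by apply: lin_extP => s; rewrite linearP.
- by apply: lin_extP => s; apply: lin_extP => t; rewrite linearP.
Qed.

Definition NF_algebra := TernaryAlgebra NF_prod_trilinear.

Lemma NF_prodU s t r :
  NF_prod (mon s) (mon t) (mon r) = signed_sum mon (nmul s t r).
Proof. by rewrite /NF_prod !lin_extU. Qed.

Lemma signed_sum_nmul (U : lmodType rat) (F : tmon X -> U) s t r :
  signed_sum F (nmul s t r) =
  signed_sum (fun b => signed_sum (fun c =>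
    signed_sum F (sort2 s b c)) (inner_nf r)) (inner_nf t).
Proof. by rewrite signed_sum_prod3 signed_sum1 scale1r. Qed.

Lemma inner_nf_alt12 (U : lmodType rat) (F : tmon X -> U) a b c :
  signed_sum F (inner_nf (TNode a b c)) = - signed_sum F (inner_nf (TNode b a c)).
Proof.
rewrite /= !signed_sum_prod3 [in LHS]signed_sum_exchange -signed_sum_opp.
apply: eq_signed_sum => b'; rewrite -signed_sum_opp; apply: eq_signed_sum => a'.
by rewrite -signed_sum_opp; apply: eq_signed_sum => c'; exact: sort3_alt12.
Qed.

Lemma inner_nf_alt23 (U : lmodType rat) (F : tmon X -> U) a b c :
  signed_sum F (inner_nf (TNode a b c)) = - signed_sum F (inner_nf (TNode a c b)).
Proof.
rewrite /= !signed_sum_prod3 -signed_sum_opp; apply: eq_signed_sum => a'.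
rewrite signed_sum_exchange -signed_sum_opp; apply: eq_signed_sum => c'.
by rewrite -signed_sum_opp; apply: eq_signed_sum => b'; exact: sort3_alt23.
Qed.

(** Straightening the last two factors beforehand leaves the inner normal form unchanged, because
    [inner_nf] alternates and fixes inner normal monomials. Thus [NF_prod] sees a product in second
    place through its alternating [inner_nf], which yields the second PATA identity. *)
Lemma nmul_inner_nf (U : lmodType rat) (F : tmon X -> U) s t r :
  signed_sum (fun p => signed_sum F (inner_nf p)) (nmul s t r) =
  signed_sum F (inner_nf (TNode s t r)).
Proof.
rewrite signed_sum_nmul /= signed_sum_prod3 [RHS]signed_sum_exchange.
apply: eq_signed_sum_in => b /inner_nf_normal Nb.
rewrite [RHS]signed_sum_exchange.
apply: eq_signed_sum_in => c /inner_nf_normal Nc.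
rewrite sort2E; last by move=> *; exact: inner_nf_alt23.
rewrite /= signed_sum_prod3; apply: eq_signed_sum => a.
by rewrite !inner_nfE // !signed_sum1 !scale1r.
Qed.

Lemma NF_algebra_isPATA : isPATA NF_algebra.
Proof.
apply: isPATA_basis => [s t r|s a b c r].
  rewrite -!/(mon _) (NF_prodU s t r) (NF_prodU s r t); apply/eqP.
  rewrite addr_eq0 (signed_sum_nmul _ s t r) (signed_sum_nmul _ s r t).
  rewrite -signed_sum_opp; apply/eqP; rewrite [LHS]signed_sum_exchange.
  apply: eq_signed_sum => r'; rewrite -signed_sum_opp.
  by apply: eq_signed_sum => t'; exact: sort2_alt.
pose F t := signed_sum (fun d => signed_sum mon (sort2 s t d)) (inner_nf r).
have [_ n2 _] := NF_prod_trilinear.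
have E a' b' : NF_prod (mon s) (NF_prod (mon a') (mon b') (mon c)) (mon r) =
    signed_sum F (inner_nf (TNode a' b' c)).
  rewrite (NF_prodU a') (linear_signed_sum _ _ (n2 _ _)) -nmul_inner_nf.
  by apply: eq_signed_sum => t; rewrite (NF_prodU s) signed_sum_nmul.
apply: etrans (congr2 +%R (E a b) (E b a)) _.
by rewrite (inner_nf_alt12 F a b c) addNr.
Qed.

Let gen (i : X) : NF_algebra := mon (TVar i).

Lemma NF_eval_normal t : top_normal t ->
  tmon_eval gen t = mon t.
Proof.
elim: t => //= a IHa b _ c _ /and4P[/IHa-> Nb Nc bc].
have I d : inner_normal d ->
    tmon_eval gen d = mon d.
  elim: d => //= a' IHa' b' IHb' c' IHc'.
  case/and5P=> Na' Nb' Nc' _ bc'; rewrite IHa' // IHb' // IHc' //.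
  rewrite /tprod /= NF_prodU signed_sum_nmul !inner_nfE //.
  by rewrite !signed_sum1 !scale1r /sort2 bc' signed_sum1 scale1r.
rewrite !I // /tprod /= NF_prodU signed_sum_nmul !inner_nfE //.
by rewrite !signed_sum1 !scale1r /sort2 bc signed_sum1 scale1r.
Qed.

Lemma normal_mon_free (s : seq (tmon X)) (c : tmon X -> rat) :
  uniq s -> all top_normal s -> \sum_(t <- s) c t *: PATA_mon t = 0 ->
  {in s, forall t, c t = 0}.
Proof.
move=> Us /allP Ns /(congr1 (PATA_eval gen)).
have L := PATA_eval_is_linear gen NF_algebra_isPATA.
have -> : PATA_eval gen (\sum_(t <- s) c t *: PATA_mon t) = \sum_(t <- s) c t *: mon t.
  rewrite big_seq [RHS]big_seq; elim/big_rec2: _ => [|t y z st <-].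
    exact: linear_at0.
  rewrite L PATA_eval_mon ?NF_eval_normal ?Ns //; exact: NF_algebra_isPATA.
rewrite (linear_at0 L) => E t st; move/(congr1 (fun u : FT X => u@_t)): E.
rewrite mcoeff0 raddf_sum (bigD1_seq t) //= big1 ?addr0 => [|r rt].
  by rewrite mcoeffZ mcoeffUU mulr1.
by rewrite mcoeffZ mcoeffU (negPf rt) mulr0.
Qed.
End NormalAlgebra.
End NormalForm.

(** * The straightened monomials of content 211111 *)

Section LexicographicPermutations.
Variable T : eqType.

(** [undup] avoids repetitions, and a sorted [s] gives lexicographic order. *)
Fixpoint lex_perms (n : nat) (s : seq T) : seq (seq T) :=
  if n is n'.+1 then
    flatten [seq [seq x :: w | w <- lex_perms n' (rem x s)] | x <- undup s]
  else [:: [::]].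

Lemma mem_lex_perms s w : (w \in lex_perms (size s) s) = perm_eq w s.
Proof.
move en : (size s) => n; elim: n s en w => [|n IH] s sn w /=.
  move/size0nil: sn => ->; rewrite inE.
  by apply/eqP/idP => [->//|/perm_nilP].
apply/flattenP/idP => [[u /mapP[x]]|ws].
  rewrite mem_undup => sx -> /mapP[v].
  rewrite IH ?size_rem ?sn // => pv ->.
  by rewrite perm_sym (permPl (perm_to_rem sx)) perm_cons perm_sym.
case: w ws => [/perm_size|x v xv]; first by rewrite sn.
have sx : x \in s by rewrite -(perm_mem xv) mem_head.
exists [seq x :: w | w <- lex_perms n (rem x s)].
  by apply/mapP; exists x; rewrite ?mem_undup.
rewrite map_f // IH ?size_rem ?sn //.
by move: xv; rewrite perm_sym (permPl (perm_to_rem sx)) perm_cons perm_sym.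
Qed.
End LexicographicPermutations.

(** A strictly increasing list is determined by its members, so the sort itself is never run. *)
Lemma sort_permutations (s : seq letter) (ws : seq (seq letter)) :
  sorted lex_lt ws -> (forall w, (w \in ws) = perm_eq w s) ->
  sort lex_le (permutations s) = ws.
Proof.
move=> lt_ws ws_s; have ws_uniq : uniq ws.
  by apply: sorted_uniq lt_ws => [u v w|u]; [exact: lt_trans | exact: ltxx].
apply: (sorted_eq (leT := lex_le)).
- by move=> u v w; exact: le_trans.
- by move=> u v; exact: le_anti.
- by apply: sort_sorted => u v; exact: le_total.
- by apply: sub_sorted lt_ws => u v; exact: ltW.
rewrite perm_sort; apply: uniq_perm => //; first exact: permutations_uniq.
by move=> w; rewrite mem_permutations ws_s.
Qed.

Definition words : seq (seq letter) := lex_perms 7 content211111.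

Lemma words211111E : words211111 = words.
Proof.
apply: sort_permutations; first by vm_compute.
exact: (mem_lex_perms content211111).
Qed.

Definition smons : seq (tmon letter) :=
  flatten [seq pmap (straightened k) words | k <- [:: 1; 2; 3; 4; 5]].

Lemma smons211111E : smons211111 = smons.
Proof. by rewrite /smons211111 words211111E. Qed.

(* Polish notation: a node is 0 and precedes every variable. *)
Fixpoint tcode (t : tmon letter) : seq nat :=
  if t is TNode a b c then 0 :: tcode a ++ tcode b ++ tcode c
  else if t is TVar x then [:: x.+1] else [::].

(** Polish notation is a prefix code; the arbitrary rests [s] and [s'] carry the induction. *)
Lemma tcode_cat_inj t t' s s' :
  tcode t ++ s = tcode t' ++ s' -> t = t' /\ s = s'.
Proof.
elim: t t' s s' => [x|a IHa b IHb c IHc] [x'|a' b' c'] s s' //=.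
  by case=> /val_inj -> ->.
by case; rewrite -!catA => /IHa[-> /IHb[-> /IHc[-> ->]]].
Qed.

(** As 0 begins the code of every product, products precede variables, and products of three
    variables compare lexicographically. This is the order under which normal means straightened. *)
Definition tkey (t : tmon letter) : seqlexi nat := tcode t.
Arguments tkey t : simpl never.

Lemma tkey_inj : injective tkey.
Proof.
move=> t t' E; have [] // := @tcode_cat_inj t t' [::] [::].
by rewrite !cats0.
Qed.

Lemma tkey_var x y : (tkey (TVar x) < tkey (TVar y))%O = (x < y)%N.
Proof. by rewrite /tkey /= ltxi_cons !leEnat ltxx implybF !ltnS; case: ltngtP. Qed.

Lemma tkey_var_node x a b c : (tkey (TVar x) < tkey (TNode a b c))%O = false.
Proof. by rewrite /tkey /= ltxi_cons. Qed.

Lemma tkey_node_var x a b c : (tkey (TNode a b c) < tkey (TVar x))%O.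
Proof. by rewrite /tkey /= ltxi_cons. Qed.

Lemma smons_normal : all (top_normal tkey) smons.
Proof. by vm_compute. Qed.

Lemma smons_leaves : all (fun t => perm_eq (tleaves t) content211111) smons.
Proof. by vm_compute. Qed.

Lemma smons_uniq : uniq smons.
Proof. by apply: (@map_uniq _ _ tcode); vm_compute. Qed.

Lemma size_smons : size smons = 805%N.
Proof. by vm_compute. Qed.

Lemma tkey_node3 x y z x' y' z' :
  (tkey (TNode (TVar x) (TVar y) (TVar z)) <
   tkey (TNode (TVar x') (TVar y') (TVar z')))%O =
  lex_lt [:: x; y; z] [:: x'; y'; z'].
Proof. by rewrite /tkey /lex_lt /= !ltxi_cons !leEnat !ltnS !leEord. Qed.

(** * Shapes of monomials of degree up to 7 *)

Section Shapes.
Variable X : Type.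
Implicit Types t : tmon X.

Lemma tleaves_odd t : odd (size (tleaves t)).
Proof.
by elim: t => //= a IHa b IHb c IHc; rewrite !size_cat !oddD IHa IHb IHc.
Qed.

Lemma tleaves1 t : size (tleaves t) = 1%N -> exists x, t = TVar x.
Proof.
case: t => [x|a b c] /=; first by exists x.
rewrite !size_cat; by have := tleaves_odd a; have := tleaves_odd b; lia.
Qed.

Lemma tleaves_node (a b c : tmon X) n : size (tleaves (TNode a b c)) = n ->
  (size (tleaves a) + size (tleaves b) + size (tleaves c) = n)%N.
Proof. by rewrite /= !size_cat addnA. Qed.

Lemma tleaves3 t : size (tleaves t) = 3%N ->
  exists x y z, t = TNode (TVar x) (TVar y) (TVar z).
Proof.
case: t => [x|a b c] // /tleaves_node.
have := tleaves_odd a; have := tleaves_odd b; have := tleaves_odd c => oc ob oa E.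
have [|x ->] := @tleaves1 a; first by lia.
have [|y ->] := @tleaves1 b; first by lia.
have [|z ->] := @tleaves1 c; first by lia.
by exists x, y, z.
Qed.

Lemma tleaves5 t : size (tleaves t) = 5%N ->
  exists x y z u v, let n := TNode (TVar x) (TVar y) (TVar z) in
  [\/ t = TNode n (TVar u) (TVar v), t = TNode (TVar u) n (TVar v)
    | t = TNode (TVar u) (TVar v) n].
Proof.
case: t => [x|a b c] // /tleaves_node.
have := tleaves_odd a; have := tleaves_odd b; have := tleaves_odd c => oc ob oa E.
have [a3|[b3|c3]] : size (tleaves a) = 3%N \/ size (tleaves b) = 3%N \/
    size (tleaves c) = 3%N by lia.
- have [x [y [z ->]]] := tleaves3 a3.
  have [|u ->] := @tleaves1 b; first by lia.
  have [|v ->] := @tleaves1 c; first by lia.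
  by exists x, y, z, u, v; constructor 1.
- have [x [y [z ->]]] := tleaves3 b3.
  have [|u ->] := @tleaves1 a; first by lia.
  have [|v ->] := @tleaves1 c; first by lia.
  by exists x, y, z, u, v; constructor 2.
- have [x [y [z ->]]] := tleaves3 c3.
  have [|u ->] := @tleaves1 a; first by lia.
  have [|v ->] := @tleaves1 b; first by lia.
  by exists x, y, z, u, v; constructor 3.
Qed.

Lemma tleaves7 t : size (tleaves t) = 7%N ->
  exists a b c, t = TNode a b c /\
  let sizes := (size (tleaves a), size (tleaves b), size (tleaves c)) in
  [\/ sizes = (5, 1, 1), sizes = (1, 5, 1) | sizes = (1, 1, 5)]%N \/
  [\/ sizes = (3, 3, 1), sizes = (3, 1, 3) | sizes = (1, 3, 3)]%N.
Proof.
case: t => [x|a b c] // /tleaves_node E; exists a, b, c; split=> //=.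
move: E (tleaves_odd a) (tleaves_odd b) (tleaves_odd c).
move: (size _) (size _) (size _) => p q r.
do 7?[case: p => [|p] //]; do 7?[case: q => [|q] //];
  do 7?[case: r => [|r] //] => E _ _ _; try (exfalso; lia);
  by [left; constructor | right; constructor].
Qed.
End Shapes.

Lemma straightened_smons k w t : k \in [:: 1; 2; 3; 4; 5]%N ->
  perm_eq w content211111 -> straightened k w = Some t -> t \in smons.
Proof.
move=> k5 pw E; apply/flattenP; exists (pmap (straightened k) words).
  exact: (map_f (fun k => pmap (straightened k) words)).
by rewrite mem_pmap -E map_f // (mem_lex_perms content211111).
Qed.

(** Of the six splittings of seven leaves into three odd parts, (1,1,5) and (3,1,3) put a variable
    before a product in the last two places and are not normal. The other four give the five types:
    (5,1,1) gives two, according to the shape of its first factor. *)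
Lemma top_normal_smons t :
  top_normal tkey t -> perm_eq (tleaves t) content211111 -> t \in smons.
Proof.
(* [smons] becomes a variable, so that simplification cannot evaluate the list. *)
move: smons straightened_smons => ss strS N pt.
have [a [b [c [tE]]]] := tleaves7 (perm_size pt); subst t.
case=> -[] [].
- move=> /tleaves5 Ha /tleaves1[x6 ?] /tleaves1[x7 ?]; subst b c; move: N pt.
  have [x [y [z [u [v [->|->|->]]]]]] := Ha; rewrite /= !tkey_var ?tkey_var_node ?tkey_node_var ?andbF.
  + move=> N pt; apply: (strS 1%N) pt _ => //=.
    by case/andP: N => /andP[-> ->] ->.
  + move=> N pt; apply: (strS 2%N) pt _ => //=.
    by case/andP: N => /andP[/andP[-> ->] _] ->.
  + by [].
- move=> /tleaves1[x1 ?] /tleaves5 Hb /tleaves1[x7 ?]; subst a c; move: N pt.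
  have [x [y [z [u [v [->|->|->]]]]]] := Hb; rewrite /= !tkey_var ?tkey_var_node ?tkey_node_var.
  + move=> N pt; apply: (strS 4%N) pt _ => //=.
    by case/andP: N => /andP[/andP[-> ->] ->].
  + by rewrite !andbF.
  + by rewrite !andbF.
- move=> /tleaves1[x1 ?] /tleaves1[x2 ?]; subst a b.
  by case: c N {pt} => // p q r; rewrite /= ?tkey_var_node !andbF.
- move=> /tleaves3[x1 [x2 [x3 ?]]] /tleaves3[x4 [x5 [x6 ?]]] /tleaves1[x7 ?].
  subst a b c; rewrite /= !tkey_var !tkey_node_var in N.
  apply: (strS 3%N) pt _ => //=.
  by case/and3P: N => -> /andP[-> ->].
- move=> _ /tleaves1[x1 ?]; subst b.
  by case: c N {pt} => // p q r; rewrite /= ?tkey_var_node !andbF.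
- move=> /tleaves1[x1 ?] /tleaves3[x2 [x3 [x4 ?]]] /tleaves3[x5 [x6 [x7 ?]]].
  subst a b c; rewrite /= !tkey_var tkey_node3 in N.
  apply: (strS 5%N) pt _ => //=.
  by case/and3P: N => /andP[-> ->] /andP[-> ->] ->.
Qed.

Lemma V211111_span h : V211111 h ->
  exists c : tmon letter -> rat, h = \sum_(t <- smons) c t *: PATA_mon t.
Proof.
case=> u Lu ->.
pose P (h : freePATA letter) :=
  exists c : tmon letter -> rat, h = \sum_(t <- smons) c t *: PATA_mon t.
have P0 : P 0 by exists (fun=> 0); rewrite big1 // => t _; rewrite scale0r.
have PL k x y : P x -> P y -> P (k *: x + y).
  case=> [cx ->] [cy ->]; exists (fun t => k * cx t + cy t).
  rewrite scaler_sumr -big_split; apply: eq_bigr => t _.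
  by rewrite scalerDl scalerA.
have Pm t : t \in smons -> P (PATA_mon t).
  move=> st; exists (fun r => (r == t)%:R).
  rewrite (bigD1_seq t) ?smons_uniq //= eqxx scale1r big1 ?addr0 // => r.
  by move/negPf->; rewrite scale0r.
have Pt t : perm_eq (tleaves t) content211111 -> P (PATA_mon t).
  move=> pt; rewrite PATA_monE (tmon_eval_nf tkey_inj _ (freePATA_isPATA _)).
  rewrite /signed_sum big_seq; elim/big_ind: _ => [//|x y Px Py|x nx].
    by rewrite -[x]scale1r; exact: PL.
  rewrite -[_ *: _]addr0; apply: (PL) => //; rewrite -PATA_monE; apply: Pm.
  apply: top_normal_smons; first exact: nf_normal nx.
  exact: perm_trans (nf_leaves nx) pt.
rewrite [u]monalgE big_seq.
have L := @pata_pi_is_linear (freeTernary letter).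
elim/big_rec: _ => [|t x ut Px]; first by rewrite (linear_at0 L).
rewrite malgUZ L; apply: PL => //; apply: Pt; exact: Lu.
Qed.

(** * Expansions in the free dialgebra *)

Lemma dialgebra_morph_pats (D D' : dialgebra) (f : D -> D') : linear f ->
  (forall p q, f (dleft p q) = dleft (f p) (f q)) ->
  (forall p q, f (dright p q) = dright (f p) (f q)) ->
  forall p q r, f (pats p q r) = pats (f p) (f q) (f r).
Proof.
move=> fL fl fr p q r.
have fD u v : f (u + v) = f u + f v by have := fL 1 u v; rewrite !scale1r.
have fN u : f (- u) = - f u.
  by have := fL (-1) u 0; rewrite (linear_at0 fL) !addr0 !scaleN1r.
by rewrite /pats !(fD, fN) !(fl, fr).
Qed.

Lemma pats_closed (D : dialgebra) (T : Type) (M : T -> D) (l r : T -> T -> T) :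
  (forall p q, dleft (M p) (M q) = M (l p q)) ->
  (forall p q, dright (M p) (M q) = M (r p q)) ->
  forall a b c, pats (M a) (M b) (M c) =
    signed_sum M [:: (false, l (l a b) c); (true, l (l a c) b);
                     (true, l (r b a) c); (false, l (r c a) b);
                     (false, r (r b c) a); (true, r (r c b) a)].
Proof.
move=> lE rE a b c; rewrite /pats !(lE, rE) /signed_sum.
by rewrite !big_cons big_nil /= addr0 !scale1r !scaleN1r !addrA.
Qed.

Section PATSExpansion.
Variable X : choiceType.

Let expand (t : tmon X) : freeDialgebra X :=
  tmon_eval (A := pats_algebra (freeDialgebra X)) (@FD_gen X) t.

(** By universality, an identity holding for the generators of the free dialgebra holds in all
    dialgebras. *)
Lemma tmon_eval_pats (D : dialgebra) (x : X -> pats_algebra D) t :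
  tmon_eval x t = FD_eval x (expand t).
Proof.
elim: t => [i|a IHa b IHb c IHc]; first exact/esym/FD_eval_gen.
rewrite -[LHS]/(pats (tmon_eval x a) (tmon_eval x b) (tmon_eval x c)).
rewrite -[expand _]/(pats (expand a) (expand b) (expand c)) IHa IHb IHc.
apply/esym/dialgebra_morph_pats; first exact: FD_eval_is_linear.
  exact: FD_eval_left.
exact: FD_eval_right.
Qed.

(** All six terms keep the center of the first factor; the other two factors enter through their
    underlying words [u] and [v]. *)
Definition pats_terms (s t r : dmon X) : seq (bool * dmon X) :=
  let: (l, c, r1) := s in
  let: (l2, c2, r2) := t in let u := l2 ++ c2 :: r2 in
  let: (l3, c3, r3) := r in let v := l3 ++ c3 :: r3 in
  [:: (false, (l, c, r1 ++ u ++ v)); (true, (l, c, r1 ++ v ++ u));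
      (true, (u ++ l, c, r1 ++ v)); (false, (v ++ l, c, r1 ++ u));
      (false, (u ++ v ++ l, c, r1)); (true, (v ++ u ++ l, c, r1))].

Fixpoint expansion_terms (t : tmon X) : seq (bool * dmon X) :=
  match t with
  | TVar x => [:: (false, ([::], x, [::]))]
  | TNode a b c => prod3 pats_terms (expansion_terms a) (expansion_terms b)
                     (expansion_terms c)
  end.

Let mon (d : dmon X) : FD X := << d >>.

Lemma pats_mon s t r : pats (D := freeDialgebra X) (mon s) (mon t) (mon r) =
  signed_sum mon (pats_terms s t r).
Proof.
have lE p q : dleft (d := freeDialgebra X) (mon p) (mon q) = mon (dmon_left p q).
  exact: bilin_extU.
have rE p q : dright (d := freeDialgebra X) (mon p) (mon q) = mon (dmon_right p q).
  exact: bilin_extU.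
rewrite (pats_closed lE rE); congr signed_sum.
case: s t r => [[l c] r1] [[l2 c2] r2] [[l3 c3] r3] /=.
by do ! rewrite -?catA /=.
Qed.

Lemma tmon_eval_FD t : expand t = signed_sum mon (expansion_terms t).
Proof.
have [n1 n2 n3] := pats_trilinear (freeDialgebra X).
elim: t => [x|a IHa b IHb c IHc]; first by rewrite signed_sum1 scale1r.
rewrite signed_sum_prod3 -[LHS]/(pats (expand a) (expand b) (expand c)).
rewrite IHa (linear_signed_sum _ _ (n1 _ _)); apply: eq_signed_sum => s.
rewrite IHb (linear_signed_sum _ _ (n2 _ _)); apply: eq_signed_sum => r.
rewrite IHc (linear_signed_sum _ _ (n3 _ _)); apply: eq_signed_sum => p.
exact: pats_mon.
Qed.
End PATSExpansion.

(** * Coordinates in the straightened monomials *)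

Local Notation smon := smon211111.
Local Notation nsmons := (size smons211111).

Lemma lin_comb_is_linear : linear lin_comb.
Proof.
move=> c u v; rewrite /lin_comb scaler_sumr -big_split; apply: eq_bigr => j _.
by rewrite !mxE scalerDl scalerA.
Qed.

Lemma sum_smons (U : lmodType rat) (F : tmon letter -> U) :
  \sum_(t <- smons) F t = \sum_j F (smon j).
Proof. by rewrite -smons211111E (big_nth (TVar la)) big_mkord. Qed.

Lemma smon_inj : injective smon.
Proof.
move=> i j /eqP; rewrite nth_uniq ?ltn_ord ?smons211111E ?smons_uniq //.
by move/eqP/val_inj.
Qed.

Lemma mem_smon j : smon j \in smons.
Proof. by rewrite -smons211111E mem_nth. Qed.

Lemma lin_comb_eq0 v : lin_comb v = 0 -> v = 0.
Proof.
pose c t := \sum_(j | smon j == t) v j 0.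
have cE j : c (smon j) = v j 0.
  by rewrite /c (big_pred1 j) // => i; rewrite (inj_eq smon_inj).
have -> : lin_comb v = \sum_(t <- smons) c t *: PATA_mon t.
  by rewrite sum_smons; apply: eq_bigr => j _; rewrite cE.
move=> /(normal_mon_free tkey_inj smons_uniq smons_normal) H.
by apply/colP => j; rewrite mxE -cE H ?mem_smon.
Qed.

Lemma lin_comb_inj : injective lin_comb.
Proof.
move=> u v E; apply/eqP; rewrite -subr_eq0; apply/eqP/lin_comb_eq0.
by rewrite -scaleN1r addrC lin_comb_is_linear E scaleN1r addNr.
Qed.

Lemma coordsK v : coords (lin_comb v) = v.
Proof.
by apply: xget_unique; [exact: erefl | move=> w /lin_comb_inj/esym; exact].
Qed.

Lemma V211111P h : V211111 h <-> exists v, h = lin_comb v.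
Proof.
split=> [/V211111_span[c ->]|[v ->]].
  exists (\col_j c (smon j)); rewrite sum_smons.
  by apply: eq_bigr => j _; rewrite mxE.
exists (\sum_j v j 0 *: << smon j >> : FT letter) => [t|].
  case/msupp_sumU => j ->; exact: (allP smons_leaves _ (mem_smon j)).
have L := @pata_pi_is_linear (freeTernary letter).
rewrite /lin_comb; elim/big_rec2: _ => [|j x y _ ->]; last by rewrite L.
by rewrite (linear_at0 L).
Qed.

Lemma PATA_eval_lin_comb (A : ternaryAlgebra) (x : letter -> A) v :
  isPATA A -> PATA_eval x (lin_comb v) = \sum_j v j 0 *: tmon_eval x (smon j).
Proof.
move=> PA; have L := PATA_eval_is_linear x PA.
rewrite /lin_comb; elim/big_rec2: _ => [|j y z _ <-]; first exact: linear_at0.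
by rewrite L PATA_eval_mon.
Qed.

Lemma satisfied_lin_comb v : satisfied_by_PATS (lin_comb v) <->
  \sum_j v j 0 *: expansion (smon j) = 0.
Proof.
split=> [/(_ _ (@FD_gen letter))|E D x].
  by rewrite PATA_eval_lin_comb //; exact: pats_isPATA.
rewrite PATA_eval_lin_comb; last exact: pats_isPATA.
have L := FD_eval_is_linear (x : letter -> D).
transitivity (FD_eval x (\sum_j v j 0 *: expansion (smon j))).
  elim/big_rec2: _ => [|j y z _ ->]; first by rewrite (linear_at0 L).
  by rewrite L tmon_eval_pats.
by rewrite E (linear_at0 L).
Qed.

Lemma E211111_mul (v : 'cV_nsmons) i : (E211111 *m v) i 0 =
  (\sum_j v j 0 *: expansion (smon j) : FD letter)@_
    (nth ([::], la, [::]) dmons211111 i).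
Proof.
rewrite mxE mcoeff_sumZ; apply: eq_bigr => j _.
by rewrite mxE mulrC.
Qed.

(** * Row canonical form from a basis of the nullspace *)

Section KernelData.
Variables (F : fieldType) (m n d : nat) (A : 'M[F]_(m, n)).
Variables (J : 'I_d -> 'I_n) (K : 'I_d -> 'cV[F]_n).
Hypothesis KJ : forall i i', K i (J i') 0 = (i == i')%:R.
Hypothesis K0 : forall i (k : 'I_n), (J i < k)%N -> K i k 0 = 0.
Hypothesis AK : forall i, A *m K i = 0.
Hypothesis A0 : forall v : 'cV[F]_n, A *m v = 0 -> (forall i, v (J i) 0 = 0) -> v = 0.
Hypothesis le_m : (n - d <= m)%N.

Let Jset : {set 'I_n} := [set J i | i in 'I_d].
Let piv : seq 'I_n := [seq p <- enum 'I_n | p \notin Jset].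

Lemma kernel_data_injective : injective J.
Proof.
move=> i i' E; apply/eqP; have := KJ i i'; rewrite -E KJ eqxx.
by case: eqP => // _ /eqP; rewrite oner_eq0.
Qed.

Lemma kernel_dataP (v : 'cV[F]_n) : A *m v = 0 <-> v = \sum_i v (J i) 0 *: K i.
Proof.
split=> [Av|->]; last first.
  rewrite mulmx_sumr big1 // => i _.
  by rewrite -scalemxAr AK scaler0.
apply/eqP; rewrite -subr_eq0; apply/eqP/A0.
  rewrite mulmxBr Av mulmx_sumr big1 ?subr0 // => i _.
  by rewrite -scalemxAr AK scaler0.
move=> i; rewrite !mxE summxE (bigD1 i) //= big1 => [|i' ii'].
  by rewrite mxE KJ eqxx mulr1 addr0 subrr.
by rewrite mxE KJ (negPf ii') mulr0.
Qed.

Let size_piv : (size piv <= m)%N.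
Proof.
apply: leq_trans le_m; rewrite size_filter -sum1_count -big_filter.
rewrite big_filter big_enum_cond /= sum1_card.
have -> : #|[pred p | p \notin Jset]| = #|~: Jset| by apply: eq_card => p; rewrite !inE.
by rewrite cardsCs finset.setCK card_ord card_imset ?card_ord //; exact: kernel_data_injective.
Qed.

Let pivP (p : 'I_n) : (p \in piv) = (p \notin Jset).
Proof. by rewrite mem_filter mem_enum andbT. Qed.

Let piv_uniq : uniq piv. Proof. by rewrite filter_uniq ?enum_uniq. Qed.

Let piv_lt (j0 : 'I_n) (i i' : nat) :
  (i < i' < size piv)%N -> (nth j0 piv i < nth j0 piv i')%N.
Proof.
have S : sorted (fun p q : 'I_n => (p < q)%N) piv.
  apply: sorted_filter => [p q r|]; first exact: ltn_trans.
  by have := iota_ltn_sorted 0 n; rewrite -val_enum_ord sorted_map.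
case/andP=> ii' si'; apply: (sorted_ltn_nth _ _ S) => //.
  by move=> p q r; exact: ltn_trans.
by rewrite inE; exact: ltn_trans ii' si'.
Qed.

(** Each nonzero row is the equation that expresses a pivot variable p through the free variables.
    Where [K i'] is nonzero at p, [K0] puts p before [J i'], so p is the leading column. The
    remaining rows are zero, and [le_m] makes the pivot rows fit. *)
Let R : 'M[F]_(m, n) := \matrix_(i, j)
  if (i < size piv)%N then (j == nth j piv i)%:R -
    \sum_i' (j == J i')%:R * K i' (nth j piv i) 0 else 0.

Let RJ (i : 'I_m) j' i' : (i < size piv)%N -> R i (J i') = - K i' (nth j' piv i) 0.
Proof.
move=> si; rewrite mxE si (set_nth_default j') //.
have /negPf-> : J i' != nth j' piv i.
  by apply/eqP => E; have := mem_nth j' si; rewrite pivP -E imset_f.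
rewrite sub0r (bigD1 i') //= eqxx mul1r big1 ?addr0 // => k ki.
by rewrite (inj_eq kernel_data_injective) eq_sym (negPf ki) mul0r.
Qed.

Let Rpiv (i : 'I_m) j : j \notin Jset -> R i j = ((i < size piv)%N && (j == nth j piv i))%:R.
Proof.
move=> jJ; rewrite mxE; case: ifP => //= si.
rewrite big1 ?subr0 // => i' _; case: eqP => [E|]; last by rewrite mul0r.
by rewrite E imset_f in jJ.
Qed.

Let R_leading (i : 'I_m) j : leading R i j = (i < size piv)%N && (j == nth j piv i).
Proof.
have [si|si] /= := boolP (i < size piv)%N; last first.
  by rewrite /leading mxE (negPf si) eqxx.
have pJ : nth j piv i \notin Jset by rewrite -pivP mem_nth.
apply/idP/eqP => [/andP[Rj /forallP R0]|->].
  have [jJ|/(Rpiv i) E] := boolP (j \in Jset); last first.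
    by move: Rj; rewrite E si /=; case: (j =P _) => // _; rewrite eqxx.
  have [i' _ jE] := imsetP jJ; move: Rj.
  rewrite {1}jE (@RJ _ j _ si) oppr_eq0.
  have [lt_jp|lt_pj|E] := ltngtP j (nth j piv i).
  - by rewrite K0 ?eqxx // -jE.
  - have := R0 (nth j piv i); rewrite lt_pj Rpiv // si /=.
    by rewrite (set_nth_default j) // eqxx oner_eq0.
  - by move/val_inj: E pJ => <-; rewrite jJ.
rewrite /leading Rpiv // si (set_nth_default j) // eqxx oner_eq0 /=.
apply/forallP => k; apply/implyP => lt_kp.
have [kJ|/(Rpiv i) ->] := boolP (k \in Jset); last first.
  rewrite si (set_nth_default j) //=.
  by case: (k =P _) lt_kp => [<-|_ _]; rewrite ?ltnn ?eqxx.
have [i' _ kE] := imsetP kJ; rewrite kE (@RJ _ j _ si) K0 ?oppr0 //.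
by rewrite -kE.
Qed.

Let R_rref : is_rref R.
Proof.
split=> [i i' ii' /rowP Ri|i j|i i' j j'|i i' j].
- have si : (size piv <= i)%N.
    rewrite leqNgt; apply/negP => si.
    have [j0 _] : exists j0 : 'I_n, True.
      by case: (piv) si => // j0 _ _; exists j0.
    have pJ : nth j0 piv i \notin Jset by rewrite -pivP mem_nth.
    have := Ri (nth j0 piv i); rewrite mxE [RHS]mxE Rpiv // si.
    by rewrite (set_nth_default j0) // eqxx => /eqP; rewrite oner_eq0.
  apply/rowP => j; rewrite !mxE ifN // -leqNgt.
  exact: leq_trans si (ltnW ii').
- rewrite R_leading => /andP[si /eqP E]; rewrite Rpiv ?si -?E ?eqxx //.
  by rewrite -pivP E mem_nth.
- rewrite !R_leading => /andP[si /eqP->] /andP[si' /eqP->] ii'.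
  by rewrite (set_nth_default j' j) // piv_lt // ii'.
- rewrite R_leading => /andP[si /eqP E] ii'; rewrite Rpiv; last first.
    by rewrite -pivP E mem_nth.
  case: ltnP => //= si'; rewrite {1}E.
  by rewrite nth_uniq // eq_sym (inj_eq val_inj) (negPf ii').
Qed.

Let R_ker (v : 'cV[F]_n) : R *m v = 0 <-> v = \sum_i v (J i) 0 *: K i.
Proof.
have Rv (i : 'I_m) j0 : (i < size piv)%N -> (R *m v) i 0 =
    v (nth j0 piv i) 0 - \sum_i' v (J i') 0 * K i' (nth j0 piv i) 0.
  move=> si; rewrite mxE (bigID (mem Jset)) /= addrC.
  rewrite (bigD1 (nth j0 piv i)) /=; last by rewrite -pivP mem_nth.
  rewrite Rpiv -?pivP ?mem_nth // si (set_nth_default j0) // eqxx mul1r.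
  rewrite big1 ?addr0 => [|k /andP[kJ kp]]; last first.
    by rewrite Rpiv // si (set_nth_default j0) // (negPf kp) mul0r.
  congr (_ + _); rewrite -sumrN big_imset /=; last first.
    by move=> ? ? _ _; exact: kernel_data_injective.
  by apply: eq_bigr => i' _; rewrite (@RJ _ j0 _ si) mulNr mulrC.
split=> [Rv0|vE].
  apply/colP => p; rewrite summxE.
  under eq_bigr => i _ do rewrite mxE.
  have [pJ|pJ] := boolP (p \in Jset).
    have [i _ ->] := imsetP pJ; rewrite (bigD1 i) //= KJ eqxx mulr1.
    by rewrite big1 ?addr0 // => i' ii'; rewrite KJ (negPf ii') mulr0.
  have si : (index p piv < size piv)%N by rewrite index_mem pivP.
  have := Rv (Ordinal (leq_trans si size_piv)) p si.
  rewrite Rv0 mxE /= nth_index ?pivP // => /esym/eqP.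
  by rewrite subr_eq0 => /eqP.
apply/colP => i; rewrite [RHS]mxE.
have [si|si] := ltnP i (size piv); last first.
  by rewrite mxE big1 // => j _; rewrite mxE ltnNge si /= mul0r.
have [j0 _] : exists j0 : 'I_n, True.
  by case: (piv) si => // j0 _ _; exists j0.
rewrite (Rv _ j0) // {1}vE summxE; apply/eqP; rewrite subr_eq0; apply/eqP.
by apply: eq_bigr => i' _; rewrite mxE.
Qed.

(** [R] and [A] have the same nullspace, spanned by the [K i], hence the same row space, and so
    differ by an invertible left factor. The values of [K i] at the free columns single it out as a
    canonical solution. *)
Lemma row_canonical_form_kernel : exists2 R : 'M[F]_(m, n),
  row_canonical_form A R &
  (forall j, free_column R j = (j \in [seq J i | i <- enum 'I_d])) /\
  forall i, canonical_solution R (J i) = K i.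
Proof.
have RF j : free_column R j = (j \in Jset).
  apply/forallP/idP => [H|jJ i].
    apply: contraTT isT => jJ; have si : (index j piv < size piv)%N.
      by rewrite index_mem pivP.
    have := H (Ordinal (leq_trans si size_piv)).
    by rewrite R_leading /= si nth_index ?pivP // eqxx.
  rewrite R_leading; apply/negP => /andP[si /eqP E].
  by have := mem_nth j si; rewrite pivP -E jJ.
exists R.
  split; first exact: R_rref.
  (* Inclusion of row spaces is tested on the columns of the cokernel of the larger one, which lie
     in the common nullspace. *)
  apply/eqmxMunitP/andP; split; rewrite submxE; apply/eqP/matrixP => i k.
    have /kernel_dataP/R_ker : A *m col k (cokermx A) = 0.
      by rewrite colE mulmxA mulmx_coker mul0mx.
    by rewrite colE mulmxA -colE => /colP/(_ i); rewrite mxE [RHS]mxE => ->;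
      rewrite mxE.
  have /R_ker/kernel_dataP : R *m col k (cokermx R) = 0.
    by rewrite colE mulmxA mulmx_coker mul0mx.
  by rewrite colE mulmxA -colE => /colP/(_ i); rewrite mxE [RHS]mxE => ->;
      rewrite mxE.
split=> [j|i].
  rewrite RF; apply/imsetP/mapP => -[i]; first by exists i; rewrite ?mem_enum.
  by exists i.
have Ji : free_column R (J i) by rewrite RF imset_f.
apply/esym/(canonical_solutionP _ R_rref Ji); split.
- by apply/R_ker/kernel_dataP.
- by rewrite KJ eqxx.
- move=> k; rewrite RF => /imsetP[i' _ ->] ii'; rewrite KJ.
  by case: (i =P i') ii' => [->|//]; rewrite eqxx.
Qed.
End KernelData.

(** * Elimination on sparse integer rows *)

Definition sparse := seq (positive * Z).

Definition ratZ (z : Z) : rat := (int_of_Z z)%:~R.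

Lemma ratZ_is_additive : {morph ratZ : x y / Z.add x y >-> x + y}.
Proof. by move=> x y; rewrite /ratZ (rmorphD int_of_Z) rmorphD. Qed.

Lemma ratZ_is_multiplicative : {morph ratZ : x y / Z.mul x y >-> x * y}.
Proof. by move=> x y; rewrite /ratZ (rmorphM int_of_Z) rmorphM. Qed.

Lemma ratZ_eq0 z : (ratZ z == 0) = Z.eqb z 0.
Proof.
rewrite /ratZ intr_eq0 -[0 in LHS](rmorph0 int_of_Z).
by rewrite (can_eq int_of_ZK); apply/eqP/Z.eqb_spec.
Qed.

(* Makes lazy evaluation compute M before it is passed to f, so that a long    *)
(* sequence of updates does not pile up unevaluated.                          *)
Definition force (T U : Type) (M : PositiveMap.t T) (f : PositiveMap.t T -> U) :=
  match M with
  | PositiveMap.Leaf => f (PositiveMap.Leaf T)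
  | PositiveMap.Node a o b => f (PositiveMap.Node a o b)
  end.

Lemma forceE (T U : Type) (M : PositiveMap.t T) (f : PositiveMap.t T -> U) :
  force M f = f M.
Proof. by case: M. Qed.

Section Dot.
Variable w : positive -> rat.

(** [w] is a candidate for a nullspace vector; row operations are judged by their effect on
    [dot]. *)
Definition dot (r : sparse) : rat := \sum_(x <- r) ratZ x.2 * w x.1.

Lemma dot_nil : dot [::] = 0. Proof. by rewrite /dot big_nil. Qed.

Lemma dot_cons j z r : dot ((j, z) :: r) = ratZ z * w j + dot r.
Proof. by rewrite /dot big_cons. Qed.

Definition sparse_scale (a : Z) (r : sparse) : sparse :=
  [seq (x.1, Z.mul a x.2) | x <- r].

Lemma dot_scale a r : dot (sparse_scale a r) = ratZ a * dot r.
Proof.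
rewrite /dot big_map mulr_sumr; apply: eq_bigr => x _.
by rewrite ratZ_is_multiplicative mulrA.
Qed.

(** It suffices to look at the head: [expansion_map] adds columns from the last to the first, so
    rows stay sorted and an entry of column [j] can only be the head. *)
Definition sparse_add1 (j : positive) (z : Z) (r : sparse) : sparse :=
  if r is (j', z') :: r' then
    if Pos.eqb j' j then
      let s := Z.add z' z in if Z.eqb s 0 then r' else (j, s) :: r'
    else (j, z) :: r
  else [:: (j, z)].

Lemma dot_add1 j z r : dot (sparse_add1 j z r) = ratZ z * w j + dot r.
Proof.
case: r => [|[j' z'] r] /=; first by rewrite dot_cons.
case: Pos.eqb_spec => [->|_]; last by rewrite dot_cons.
rewrite dot_cons addrA -mulrDl -ratZ_is_additive Z.add_comm -ratZ_eq0.
by case: eqP => [->|_]; rewrite ?dot_cons // mul0r add0r.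
Qed.

Fixpoint sparse_comb (a b : Z) (r : sparse) : sparse -> sparse :=
  if r is (i, x) :: r' then
    fix comb_r s := if s is (j, y) :: s' then
      match Pos.compare i j with
      | Eq => let z := Z.add (Z.mul a x) (Z.mul b y) in
          if Z.eqb z 0 then sparse_comb a b r' s'
          else (i, z) :: sparse_comb a b r' s'
      | Lt => (i, Z.mul a x) :: sparse_comb a b r' s
      | Gt => (j, Z.mul b y) :: comb_r s'
      end
    else sparse_scale a r
  else sparse_scale b.

Lemma dot_comb a b r s :
  dot (sparse_comb a b r s) = ratZ a * dot r + ratZ b * dot s.
Proof.
elim: r s => [|[i x] r IHr] s.
  by rewrite dot_nil mulr0 add0r; exact: dot_scale.
elim: s => [|[j y] s IHs]; first by rewrite dot_nil mulr0 addr0 -dot_scale.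
rewrite /=; case: Pos.compare_spec => [<-|_|_].
- rewrite -ratZ_eq0 ratZ_is_additive !ratZ_is_multiplicative.
  have E : ratZ a * dot ((i, x) :: r) + ratZ b * dot ((i, y) :: s) =
      (ratZ a * ratZ x + ratZ b * ratZ y) * w i + dot (sparse_comb a b r s).
    by rewrite !dot_cons IHr; ring.
  case: eqP => [E0|_]; first by rewrite E E0 mul0r add0r.
  by rewrite E dot_cons ratZ_is_additive !ratZ_is_multiplicative.
- by rewrite dot_cons IHr ratZ_is_multiplicative [dot (_ :: r)]dot_cons; ring.
- by rewrite dot_cons IHs ratZ_is_multiplicative [dot (_ :: s)]dot_cons; ring.
Qed.

Arguments sparse_comb : simpl never.

Definition sparse_map := PositiveMap.t sparse.

Definition entry (M : sparse_map) (p : positive) : sparse :=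
  odflt [::] (PositiveMap.find p M).

Lemma entry_add p r M q :
  entry (PositiveMap.add p r M) q = if Pos.eqb p q then r else entry M q.
Proof.
rewrite /entry PositiveMapAdditionalFacts.gsspec.
case: Pos.eqb_spec => [->|ne]; case: PositiveMap.E.eq_dec => // E.
by case: ne; rewrite E.
Qed.

Definition annihilated (M : sparse_map) := forall p, dot (entry M p) = 0.

(* M holds each pivot row under its leading index; n bounds the number of     *)
(* reduction steps.                                                           *)
Fixpoint reduce (n : nat) (r : sparse) (M : sparse_map) : sparse_map :=
  if n is n'.+1 then
    if r is (j, z) :: _ then
      let q := entry M j in
      if q is (_, y) :: _ then
        let g := Z.gcd y z in
        reduce n' (sparse_comb (Z.div y g) (Z.opp (Z.div z g)) r q) M
      else PositiveMap.add j r M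
    else M
  else M.

(** The row stored is a combination of annihilated rows; when the steps run out the row is dropped,
    which also keeps the invariant. *)
Lemma reduce_annihilated n r M :
  dot r = 0 -> annihilated M -> annihilated (reduce n r M).
Proof.
move=> r0 M0; elim: n r r0 => // n IH [|[j z] r] // r0 /=.
case E : (entry M j) => [|[j' y] q]; last first.
  by apply: IH; rewrite dot_comb -E M0 r0 !mulr0 addr0.
by move=> p; rewrite entry_add; case: Pos.eqb; [exact: r0 | exact: M0].
Qed.

Fixpoint eliminate (n : nat) (rs : seq sparse) (M : sparse_map) : sparse_map :=
  if rs is r :: rs' then force (reduce n r M) (eliminate n rs') else M.

Lemma eliminate_annihilated n rs M : all (fun r => dot r == 0) rs ->
  annihilated M -> annihilated (eliminate n rs M).
Proof.
elim: rs M => //= r rs IH M /andP[/eqP r0 rs0] M0.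
by rewrite forceE; apply: IH => //; exact: reduce_annihilated.
Qed.

Definition leads (j : positive) (r : sparse) : bool :=
  if r is (i, z) :: r' then
    [&& Pos.eqb i j, ~~ Z.eqb z 0 & all (fun x => Pos.ltb j x.1) r']
  else false.

Lemma leads_eq0 j r : leads j r -> dot r = 0 ->
  (forall p, Pos.lt j p -> w p = 0) -> w j = 0.
Proof.
case: r => [|[i z] r] //= /and3P[/Pos.eqb_eq-> z0 lt_j] dot0 w0.
have r0 : dot r = 0.
  elim: r lt_j {dot0} => [|[k y] r IH] /=; first by rewrite dot_nil.
  by case/andP=> /Pos.ltb_lt/w0 wk /IH r0; rewrite dot_cons wk mulr0 r0 addr0.
move/eqP: dot0; rewrite dot_cons r0 addr0 mulf_eq0 ratZ_eq0 (negPf z0).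
by move/eqP.
Qed.

(** Columns are treated from the last to the first: for a column that is not free there is an
    annihilated row leading there, and [w] already vanishes on the rest of that row. *)
Lemma back_substitution (n : nat) (free : seq positive) (M : sparse_map) :
  annihilated M -> (forall p, has (Pos.eqb p) free -> w p = 0) ->
  (forall p, (n < Pos.to_nat p)%N -> w p = 0) ->
  all (fun i => let j := Pos.of_succ_nat i in
         has (Pos.eqb j) free || leads j (entry M j)) (iota 0 n) ->
  forall p, w p = 0.
Proof.
move=> M0 free0 w_out /allP ok p.
(* [k] bounds the distance from the last column [n]. *)
suff: forall k p, (n < Pos.to_nat p + k)%N -> w p = 0.
  move/(_ n p); apply; rewrite addnC -[X in (X < _)%N]addn0 ltn_add2l.
  by apply/ssrnat.ltP; exact: Pos2Nat.is_pos.
elim=> [|k IH] {}p; first by rewrite addn0; exact: w_out.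
rewrite addnS ltnS leq_eqVlt => /orP[/eqP nE|]; last exact: IH.
have [lt_n|le_n] := ltnP n (Pos.to_nat p); first exact: w_out.
have pE : Pos.of_succ_nat (Pos.to_nat p).-1 = p.
  apply: SuccNat2Pos.inv; rewrite prednK //.
  by apply/ssrnat.ltP; exact: Pos2Nat.is_pos.
have /ok : (Pos.to_nat p).-1 \in iota 0 n.
  by rewrite mem_iota add0n; have /ssrnat.ltP := Pos2Nat.is_pos p; case: (Pos.to_nat p) le_n.
rewrite /= pE => /orP[/free0//|].
move/leads_eq0; apply; first exact: M0.
move=> q /Pos2Nat.inj_lt/ssrnat.ltP lt_pq; apply: IH; rewrite nE ltn_add2r.
exact: lt_pq.
Qed.
End Dot.

Arguments sparse_comb : simpl never.

(** * The expansion matrix and its nullspace *)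

(** One octal digit as three bits, so that words become keys of a [PositiveMap]. *)
Definition push (n : nat) (p : positive) : positive :=
  match n with
  | 0 => xO (xO (xO p)) | 1 => xI (xO (xO p))
  | 2 => xO (xI (xO p)) | 3 => xI (xI (xO p))
  | 4 => xO (xO (xI p)) | 5 => xI (xO (xI p))
  | 6 => xO (xI (xI p)) | _ => xI (xI (xI p))
  end.

Lemma push_inj m n p q :
  (m < 8)%N -> (n < 8)%N -> push m p = push n q -> m = n /\ p = q.
Proof.
by do 8?[case: m => [|m] //]; do 8?[case: n => [|n] //] => _ _ [->].
Qed.

Arguments push : simpl never.

Definition push_word (w : seq letter) (p : positive) : positive :=
  foldr (fun x : letter => push x) p w.

(* Base 8, with the digit 7 marking the center. *)
Definition dmon_code (d : dmon letter) : positive :=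
  let: (l, c, r) := d in push_word l (push 7 (push c (push_word r 1%positive))).

Lemma dmon_code_inj : injective dmon_code.
Proof.
have lt8 (x : letter) : (x < 8)%N by apply: leq_trans (ltn_ord x) _.
have word_inj w w' : push_word w 1 = push_word w' 1 -> w = w'.
  have no1 n p : push n p <> 1%positive by do 7?case: n => [|n] //.
  elim: w w' => [|x w IH] [|x' w'] //=; first by move/esym/no1.
    by move/no1.
  by case/(push_inj (lt8 x) (lt8 x')) => /val_inj-> /IH->.
have mark_inj w w' p p' : push_word w (push 7 p) = push_word w' (push 7 p') ->
    w = w' /\ p = p'.
  elim: w w' => [|x w IH] [|x' w'] /=.
  - by case/push_inj.
  - by case/(push_inj _ (lt8 x')) => // x7; have := ltn_ord x'; rewrite -x7.
  - by case/(push_inj (lt8 x)) => // x7; have := ltn_ord x; rewrite x7.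
  - by case/(push_inj (lt8 x) (lt8 x')) => /val_inj-> /IH[-> ->].
move=> [[l c] r] [[l' c'] r'] /mark_inj[->].
by case/(push_inj (lt8 c) (lt8 c')) => /val_inj-> /word_inj->.
Qed.

Fixpoint add_terms (j : positive) (s : seq (bool * dmon letter))
    (M : sparse_map) : sparse_map :=
  if s is (e, d) :: s' then
    let p := dmon_code d in
    let z := if e then Zneg xH else Zpos xH in
    force (PositiveMap.add p (sparse_add1 j z (entry M p)) M) (add_terms j s')
  else M.

(* Under the code of a dialgebra monomial, its row of the expansion matrix of *)
(* ts, whose columns are numbered from k + 1.                                 *)
Fixpoint expansion_map (k : nat) (ts : seq (tmon letter)) : sparse_map :=
  if ts is t :: ts' then
    add_terms (Pos.of_succ_nat k) (expansion_terms t) (expansion_map k.+1 ts')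
  else PositiveMap.empty sparse.

Definition code_coeff (p : positive) (s : seq (bool * dmon letter)) : rat :=
  \sum_(x <- s | Pos.eqb (dmon_code x.2) p) (-1) ^+ x.1.

Lemma dot_add_terms w j s M p : dot w (entry (add_terms j s M) p) =
  code_coeff p s * w j + dot w (entry M p).
Proof.
elim: s M => [|[e d] s IH] M /=; first by rewrite /code_coeff big_nil mul0r add0r.
rewrite forceE IH /code_coeff big_cons /= entry_add.
case: Pos.eqb_spec => [->|_] //; rewrite dot_add1 addrA mulrDl.
by congr (_ + _); rewrite addrC; congr (_ * _ + _); case: e.
Qed.

Lemma dot_expansion_map w k ts p : dot w (entry (expansion_map k ts) p) =
  \sum_(i < size ts) w (Pos.of_succ_nat (k + i)) *
    code_coeff p (expansion_terms (nth (TVar la) ts i)).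
Proof.
elim: ts k => [|t ts IH] k /=.
  by rewrite big_ord0 /entry PositiveMap.gempty /= dot_nil.
rewrite dot_add_terms IH big_ord_recl /= addn0 mulrC; congr (_ + _).
by apply: eq_bigr => i _; rewrite addnS.
Qed.

Lemma expansion_coeff t d : (expansion t : FD letter)@_d =
  code_coeff (dmon_code d) (expansion_terms t).
Proof.
rewrite /expansion tmon_eval_FD /signed_sum /code_coeff raddf_sum [RHS]big_mkcond /=.
apply: eq_bigr => -[e d'] _ /=; rewrite mcoeffZ mcoeffU.
case: Pos.eqb_spec => [/dmon_code_inj->|ne]; first by rewrite eqxx mulr1.
by case: eqP => [E|_]; [case: ne; rewrite E | rewrite mulr0].
Qed.

Local Notation pos := Pos.of_succ_nat.

(* Otherwise done and unification evaluate these lists. *)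
Local Opaque smons211111 dmons211111 words211111 smons words.

Section Weight.
Variables (n : nat) (v : 'cV[rat]_n).

(** Positives start at 1, so column [j] has number [j + 1]; the weight is 0 beyond the last
    column. *)
Definition weight (p : positive) : rat :=
  if insub (Pos.to_nat p).-1 is Some j then v j 0 else 0.

Lemma weightE (j : 'I_n) : weight (Pos.of_succ_nat j) = v j 0.
Proof. by rewrite /weight SuccNat2Pos.id_succ /= valK. Qed.

Lemma weight_out p : (n < Pos.to_nat p)%N -> weight p = 0.
Proof.
move=> lt_p; rewrite /weight insubF //; case: (Pos.to_nat p) lt_p => // k.
by rewrite ltnS => /leq_gtF.
Qed.

Lemma weight_eq0 : (forall p, weight p = 0) -> v = 0.
Proof. by move=> w0; apply/colP => j; rewrite -weightE w0 mxE. Qed.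
End Weight.

Lemma dot_smons (w : positive -> rat) (v : 'cV_(size smons211111)) d :
  (forall j : 'I_(size smons211111), w (Pos.of_succ_nat j) = v j 0) ->
  dot w (entry (expansion_map 0 smons) (dmon_code d)) =
  (\sum_j v j 0 *: expansion (smon211111 j) : FD letter)@_d.
Proof.
move=> wE; rewrite dot_expansion_map -smons211111E mcoeff_sumZ.
apply: eq_bigr => j _; rewrite expansion_coeff; congr (_ * _); exact: wE.
Qed.

Lemma mem_dmons211111 l c r :
  perm_eq (l ++ c :: r) content211111 -> (l, c, r) \in dmons211111.
Proof.
rewrite -(mem_lex_perms content211111) => wP; have := wP.
rewrite (mem_lex_perms content211111) => /perm_size szw.
apply/allpairsP; exists (l ++ c :: r, size l); split=> [||/=].
- by rewrite words211111E.
- by rewrite mem_iota -[(0 + 7)%N]szw size_cat /= addnS ltnS leq_addr.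
- rewrite take_size_cat // nth_cat ltnn subnn /=.
  by rewrite -cat_rcons drop_size_cat ?size_rcons.
Qed.

(** * The certificate: pivot rows and nullspace vectors *)

Fixpoint digits (k : nat) (n : N) : seq nat :=
  if k is k'.+1 then
    let: (q, r) := N.div_eucl n 10 in rcons (digits k' q) (N.to_nat r)
  else [::].

(* Rows of the expansion matrix found by greedy elimination.  The seven       *)
(* decimal digits of a number are the position of the center x, then the      *)
(* other letters of the word as indices into the letters available besides x. *)
(* The rows whose center is one of c, d, e, f repeat the pattern of b.        *)
Definition pivot_words_a : seq N := [::
  6012345; 6012354; 6012435; 6012453; 6012534; 6012543; 6013245; 6013254;
  6013425; 6013452; 6013524; 6013542; 6014235; 6014253; 6014325; 6014352;
  6014523; 6014532; 6015234; 6015243; 6015324; 6015342; 6015423; 6021345;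
  6021354; 6021435; 6021453; 6021534; 6023145; 6023154; 6023415; 6023451;
  6023514; 6023541; 6024135; 6024153; 6024315; 6024351; 6024513; 6024531;
  6025134; 6025143; 6025314; 6025341; 6025413; 6031245; 6031254; 6031425;
  6031452; 6031524; 6032145; 6032415; 6032451; 6032514; 6034125; 6034152;
  6034215; 6034251; 6034512; 6035124; 6035142; 6035214; 6035241; 6035412;
  6041235; 6041253; 6041325; 6041352; 6041523; 6042135; 6042315; 6042513;
  6043512; 6045123; 6045132; 6045213; 6045231; 6045312; 6051234; 6051243;
  6051324; 6051342; 6051423; 6052134; 6052314; 6052413; 6053412; 6102345;
  6102354; 6102435; 6102453; 6102534; 6103245; 6103425; 6103452; 6103524;
  6104235; 6104523; 6105234; 6120345; 6120354; 6120435; 6120453; 6120534;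
  6123045; 6123405; 6123450; 6123504; 6124035; 6124305; 6124350; 6124503;
  6125034; 6125304; 6125340; 6125403; 6130245; 6130254; 6130425; 6130452;
  6130524; 6132045; 6132405; 6132504; 6134025; 6134205; 6134502; 6135024;
  6135204; 6135402; 6140235; 6140253; 6140325; 6140352; 6140523; 6142035;
  6142305; 6142503; 6143502; 6145023; 6145203; 6145302; 6150234; 6150243;
  6150324; 6150342; 6150423; 6152034; 6152304; 6152403; 6153402; 6201345;
  6201435; 6201534; 6203145; 6203415; 6203451; 6203514; 6204513; 6213405;
  6213504; 6214503; 6230145; 6230154; 6230415; 6230451; 6230514; 6231045;
  6231405; 6231504; 6234501; 6235401; 6240135; 6240153; 6240315; 6240351;
  6240513; 6241035; 6241305; 6241503; 6243501; 6245301; 6250134; 6250143;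
  6250314; 6250341; 6250413; 6251034; 6251304; 6251403; 6253401; 6301245;
  6301425; 6304512; 6314502; 6324501; 6340125; 6340152; 6340215; 6340251;
  6340512; 6341025; 6341205; 6341502; 6342501; 6350124; 6350142; 6350214;
  6350241; 6350412; 6351024; 6351204; 6351402; 6352401; 6401235; 6450123;
  6450132; 6450213; 6450231; 6450312; 6451023; 6451203; 6451302; 6452301;
  5012345; 5012354; 5012435; 5012453; 5012534; 5013245; 5013254; 5013425;
  5013452; 5013524; 5014235; 5014253; 5014523; 5015234; 5021345; 5021354;
  5021453; 5023145; 5023154; 5023415; 5023451; 5024135; 5024153; 5025134;
  5031245; 5031452; 5034125; 5034152; 5035124; 5041235; 5045123; 5051234;
  5102345; 5120345; 5123045; 5123054; 5124035; 5130245; 5134025; 5140235;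
  5150234; 5230145; 5234015; 5240135; 5250134; 5340125; 5350124; 5450123;
  4012345]%num.

Definition pivot_words_b : seq N := [::
  1234; 1243; 1324; 1342; 1423; 1432; 2134; 2314; 2341; 2413; 2431; 3124;
  3412; 3421; 4123; 10234; 10243; 10324; 10342; 10423; 12034; 12304; 12340;
  12403; 13024; 13204; 13240; 13402; 14023; 14203; 14230; 14302; 20134; 20143;
  20314; 20341; 20413; 21034; 21304; 21403; 23014; 23104; 23401; 24013; 24103;
  24301; 30124; 30142; 30214; 30241; 30412; 31024; 31204; 31402; 32401; 34012;
  34102; 34201; 40123; 40132; 40213; 40231; 40312; 41023; 41203; 41302; 42301;
  100234; 102304; 102403; 103402; 120034; 120304; 120403; 130024; 130204;
  130402; 140023; 140203; 140302; 203401; 230014; 230104; 230401; 240013;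
  240103; 240301; 340012; 340102; 340201; 1001234; 1001324; 1001423; 1002134;
  1002314; 1002413; 1003124; 1003412; 1004123; 1010234; 1012304; 1012403;
  1013402; 1023401]%num.

Definition pivot_dmon (x : letter) (n : N) : dmon letter :=
  let ls := undup (rem x content211111) in
  let w := [seq nth la ls i | i <- behead (digits 7 n)] in
  let i := head 0%N (digits 7 n) in (take i w, x, drop i w).

Definition pivot_dmons : seq (dmon letter) :=
  [seq pivot_dmon la n | n <- pivot_words_a] ++
  flatten [seq [seq pivot_dmon x n | n <- pivot_words_b]
          | x <- [:: lb; lc; ld; le; lf]].

Lemma pivot_dmons_content :
  all (fun d => perm_eq (d.1.1 ++ d.1.2 :: d.2) content211111) pivot_dmons.
Proof. by vm_cast_no_check (erefl true). Qed.

(* The free column of each canonical basis vector, and its coordinates        *)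
(* grouped by value; columns are numbered from 0.                             *)
Definition kernel_data : seq (nat * seq (Z * seq N)) := [::
  (499%N, [:: (Zpos 1, [:: 270; 272; 274; 276; 278; 280; 282; 284; 286; 288;
    290; 291; 293; 295; 297; 299; 301; 303; 305; 307; 310; 312; 314; 316; 318;
    320; 322; 324; 326; 328; 441; 443; 444; 446; 449; 451; 452; 454; 457; 459;
    461; 463; 464; 466; 469; 471; 472; 474; 477; 479; 480; 482; 485; 487; 489;
    491; 492; 494; 497; 499]%num); (Zneg 1, [:: 271; 273; 275; 277; 279; 281;
    283; 285; 287; 289; 292; 294; 296; 298; 300; 302; 304; 306; 308; 309; 311;
    313; 315; 317; 319; 321; 323; 325; 327; 329; 440; 442; 445; 447; 448; 450;
    453; 455; 456; 458; 460; 462; 465; 467; 468; 470; 473; 475; 476; 478; 481;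
    483; 484; 486; 488; 490; 493; 495; 496; 498]%num)]);
  (663%N, [:: (Zpos 1, [:: 1; 2; 9; 10; 13; 14; 22; 28; 31; 32; 39; 40; 44;
    47; 50; 53; 55; 56; 64; 70; 74; 77; 80; 83; 271; 272; 278; 281; 283; 284;
    293; 296; 305; 308; 320; 323; 440; 441; 448; 449; 460; 461; 468; 472; 476;
    477; 488; 492; 613; 614; 618; 621; 626; 629; 633; 636; 640; 641; 645; 648;
    650; 653; 660; 663]%num); (Zneg 1, [:: 3; 4; 7; 8; 15; 16; 20; 23; 26; 29;
    33; 34; 37; 38; 46; 52; 57; 58; 62; 65; 68; 71; 76; 82; 274; 275; 287;
    290; 301; 302; 311; 314; 444; 445; 452; 456; 464; 465; 480; 484; 610; 611;
    617; 620; 622; 623; 627; 630; 632; 635; 644; 647; 651; 654; 659;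
    662]%num)]);
  (666%N, [:: (Zpos 1, [:: 0; 3; 8; 11; 16; 19; 20; 27; 29; 30; 33; 38; 41;
    45; 46; 49; 58; 61; 62; 69; 71; 76; 86; 89; 270; 275; 280; 286; 287; 299;
    302; 307; 311; 326; 442; 444; 452; 453; 462; 464; 473; 480; 481; 496; 610;
    615; 616; 617; 623; 628; 630; 632; 639; 642; 643; 644; 651; 656; 659;
    666]%num); (Zneg 1, [:: 2; 5; 6; 9; 14; 17; 21; 22; 25; 32; 35; 40; 43;
    44; 51; 53; 56; 59; 63; 64; 67; 74; 77; 88; 272; 277; 278; 284; 289; 293;
    304; 305; 317; 320; 440; 446; 448; 457; 460; 468; 469; 476; 485; 488; 612;
    614; 619; 621; 624; 625; 626; 633; 638; 641; 646; 648; 650; 657; 660;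
    665]%num)]);
  (667%N, [:: (Zpos 1, [:: 0; 3; 8; 15; 20; 27; 29; 33; 38; 45; 52; 58; 60;
    62; 71; 76; 78; 89; 275; 285; 287; 294; 300; 302; 306; 309; 311; 315; 319;
    321; 325; 327; 442; 445; 450; 453; 456; 458; 462; 465; 470; 473; 481; 484;
    493; 496; 610; 616; 620; 623; 630; 632; 639; 644; 654; 659; 661;
    667]%num); (Zneg 1, [:: 1; 9; 14; 21; 28; 32; 39; 44; 51; 53; 54; 56; 64;
    66; 72; 74; 83; 84; 272; 278; 282; 284; 288; 291; 293; 297; 303; 305; 312;
    318; 320; 322; 324; 328; 441; 443; 446; 449; 454; 457; 461; 466; 469; 472;
    474; 477; 485; 489; 492; 497; 613; 619; 621; 626; 636; 641; 648; 650; 657;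
    658; 660; 664]%num)]);
  (668%N, [:: (Zpos 1, [:: 0; 3; 4; 11; 15; 16; 23; 27; 29; 30; 33; 34; 37;
    38; 41; 42; 45; 46; 49; 52; 61; 62; 65; 68; 71; 79; 86; 89; 270; 274; 275;
    276; 280; 286; 287; 290; 295; 299; 301; 302; 303; 307; 310; 311; 312; 314;
    316; 318; 324; 326; 451; 459; 482; 494; 610; 611; 615; 616; 617; 620; 627;
    630; 639; 642; 643; 644; 647; 651; 652; 654; 656; 659; 662; 668]%num);
    (Zneg 1, [:: 1; 2; 5; 9; 10; 17; 21; 22; 28; 31; 32; 35; 36; 39; 40; 43;
    44; 47; 48; 50; 51; 53; 55; 56; 59; 67; 73; 74; 77; 80; 83; 85; 271; 272;
    273; 277; 278; 279; 281; 283; 284; 289; 292; 293; 296; 298; 300; 304; 305;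
    306; 308; 309; 313; 315; 317; 320; 321; 323; 327; 329; 447; 455; 478; 486;
    490; 498; 612; 613; 614; 618; 619; 621; 624; 633; 636; 640; 641; 645; 646;
    648; 649; 650; 653; 655; 657; 665]%num); (Zpos 2, [:: 8; 20; 58; 76; 444;
    452; 464; 480; 623; 632]%num); (Zneg 2, [:: 14; 64; 440; 448; 460; 468;
    476; 488; 626; 660]%num)]);
  (669%N, [:: (Zpos 1, [:: 3; 8; 16; 18; 20; 29; 30; 33; 37; 46; 49; 58; 61;
    68; 71; 76; 81; 86; 270; 274; 280; 286; 290; 299; 301; 303; 307; 312; 314;
    318; 324; 326; 443; 444; 451; 452; 454; 459; 464; 466; 474; 480; 482; 489;
    494; 497; 610; 617; 623; 630; 632; 634; 643; 647; 651; 656; 662;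
    669]%num); (Zneg 1, [:: 2; 9; 12; 14; 22; 24; 31; 40; 43; 50; 53; 55; 64;
    67; 75; 77; 80; 87; 271; 277; 281; 283; 289; 296; 300; 304; 306; 308; 309;
    315; 317; 321; 323; 327; 440; 447; 448; 450; 455; 458; 460; 468; 470; 476;
    478; 486; 488; 490; 493; 498; 614; 621; 626; 631; 633; 637; 640; 646; 648;
    653; 660; 665]%num)]);
  (691%N, [:: (Zpos 1, [:: 90; 92; 97; 102; 104; 109; 115; 116; 119; 121; 122;
    125; 333; 342; 348; 350; 507; 515; 517; 520; 671; 673; 677; 680; 682; 686;
    689; 691]%num); (Zneg 1, [:: 91; 96; 98; 103; 108; 110; 114; 117; 118;
    120; 123; 124; 330; 336; 339; 345; 349; 351; 503; 511; 516; 518; 519; 521;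
    670; 674; 676; 679; 683; 685; 688; 690]%num)]);
  (713%N, [:: (Zpos 1, [:: 126; 128; 133; 138; 140; 145; 151; 152; 155; 157;
    158; 161; 355; 364; 370; 372; 529; 537; 539; 542; 693; 695; 699; 702; 704;
    708; 711; 713]%num); (Zneg 1, [:: 127; 132; 134; 139; 144; 146; 150; 153;
    154; 156; 159; 160; 352; 358; 361; 367; 371; 373; 525; 533; 538; 540; 541;
    543; 692; 696; 698; 701; 705; 707; 710; 712]%num)]);
  (735%N, [:: (Zpos 1, [:: 162; 164; 169; 174; 176; 181; 187; 188; 191; 193;
    194; 197; 377; 386; 392; 394; 551; 559; 561; 564; 715; 717; 721; 724; 726;
    730; 733; 735]%num); (Zneg 1, [:: 163; 168; 170; 175; 180; 182; 186; 189;
    190; 192; 195; 196; 374; 380; 383; 389; 393; 395; 547; 555; 560; 562; 563;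
    565; 714; 718; 720; 723; 727; 729; 732; 734]%num)]);
  (757%N, [:: (Zpos 1, [:: 198; 200; 205; 210; 212; 217; 223; 224; 227; 229;
    230; 233; 399; 408; 414; 416; 573; 581; 583; 586; 737; 739; 743; 746; 748;
    752; 755; 757]%num); (Zneg 1, [:: 199; 204; 206; 211; 216; 218; 222; 225;
    226; 228; 231; 232; 396; 402; 405; 411; 415; 417; 569; 577; 582; 584; 585;
    587; 736; 740; 742; 745; 749; 751; 754; 756]%num)]);
  (779%N, [:: (Zpos 1, [:: 234; 236; 241; 246; 248; 253; 259; 260; 263; 265;
    266; 269; 421; 430; 436; 438; 595; 603; 605; 608; 759; 761; 765; 768; 770;
    774; 777; 779]%num); (Zneg 1, [:: 235; 240; 242; 247; 252; 254; 258; 261;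
    262; 264; 267; 268; 418; 424; 427; 433; 437; 439; 591; 599; 604; 606; 607;
    609; 758; 762; 764; 767; 771; 773; 776; 778]%num)]);
  (789%N, [:: (Zpos 1, [:: 4; 8; 11; 16; 20; 23; 34; 38; 41; 46; 58; 62; 65;
    76; 270; 274; 276; 280; 282; 286; 288; 290; 291; 295; 297; 299; 301; 303;
    307; 310; 312; 314; 316; 318; 322; 324; 326; 328; 444; 452; 464; 480; 611;
    615; 617; 623; 627; 632; 642; 644; 651; 659; 780; 782; 784; 786; 787;
    789]%num); (Zneg 1, [:: 2; 5; 10; 14; 17; 22; 32; 35; 40; 44; 47; 56; 59;
    64; 74; 77; 271; 273; 277; 279; 281; 283; 285; 289; 292; 294; 296; 298;
    300; 304; 306; 308; 309; 313; 315; 317; 319; 321; 323; 325; 327; 329; 440;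
    448; 460; 468; 476; 488; 612; 614; 618; 624; 626; 633; 641; 645; 650; 660;
    781; 783; 785; 788]%num)])].
Definition kernel_map (s : seq (Z * seq N)) : PositiveMap.t Z :=
  foldr (fun x M => foldr (fun j => PositiveMap.add (N.succ_pos j) x.1) M x.2)
    (PositiveMap.empty Z) s.

Definition kernel_maps : seq (PositiveMap.t Z) :=
  [seq kernel_map k.2 | k <- kernel_data].

Definition kernel_pivots : seq nat := [seq k.1 | k <- kernel_data].

Definition kernel_coeff (M : PositiveMap.t Z) (p : positive) : Z :=
  odflt Z0 (PositiveMap.find p M).

Definition kernel_dot (M : PositiveMap.t Z) (r : sparse) : Z :=
  foldr (fun x s => Z.add (Z.mul x.2 (kernel_coeff M x.1)) s) Z0 r.

Lemma ratZ_kernel_dot M r :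
  ratZ (kernel_dot M r) = dot (fun p => ratZ (kernel_coeff M p)) r.
Proof.
elim: r => [|[j z] r IH] /=; first by rewrite dot_nil.
by rewrite dot_cons -IH ratZ_is_additive ratZ_is_multiplicative.
Qed.

(** A word without an entry in the map has a zero row, so this puts the twelve vectors into the
    nullspace of all of E. *)
Lemma kernel_maps_annihilate : List.forallb
  (fun x => all (fun M => Z.eqb (kernel_dot M x.2) 0) kernel_maps)
  (PositiveMap.elements (expansion_map 0 smons)).
Proof. by vm_cast_no_check (erefl true). Qed.

(** The hypotheses [KJ] and [K0] of [row_canonical_form_kernel] over the integers; the last range
    ends at the last column, 804. *)
Lemma kernel_pivots_ok : all (fun i =>
  all (fun i' => Z.eqb (kernel_coeff (nth (PositiveMap.Leaf Z) kernel_maps i)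
      (Pos.of_succ_nat (nth 0%N kernel_pivots i'))) (Z.b2z (i == i')))
    (iota 0 12) &&
  all (fun k => Z.eqb (kernel_coeff (nth (PositiveMap.Leaf Z) kernel_maps i)
      (Pos.of_succ_nat k)) 0)
    (iota (nth 0%N kernel_pivots i).+1 (804 - nth 0%N kernel_pivots i)))
  (iota 0 12).
Proof. by vm_cast_no_check (erefl true). Qed.

(** The redex shares one expansion map among all rows. Each reduction clears the leading entry
    against a stored row, of which there are at most 793, so 800 steps suffice. *)
Definition echelon_map : sparse_map :=
  (fun M => eliminate 800 [seq entry M (dmon_code d) | d <- pivot_dmons]
              (PositiveMap.empty sparse)) (expansion_map 0 smons).

Lemma echelon_map_leads : all (fun i => let j := Pos.of_succ_nat i in
    has (Pos.eqb j) [seq Pos.of_succ_nat p | p <- kernel_pivots]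
    || leads j (entry echelon_map j)) (iota 0 805).
Proof. by vm_cast_no_check (erefl true). Qed.

(** * The nullspace obtained from the certificate *)

Definition kernel_vec (i : nat) : 'cV[rat]_nsmons :=
  \col_j ratZ (kernel_coeff (nth (PositiveMap.Leaf Z) kernel_maps i) (pos j)).

Lemma nsmonsE : nsmons = 805%N.
Proof. by rewrite smons211111E size_smons. Qed.

Lemma ltn_smons (k : 'I_nsmons) : (k < 805)%N.
Proof. by have := ltn_ord k; rewrite {2}nsmonsE. Qed.

Lemma kernel_pivot_lt (i : 'I_12) : (nth 0 kernel_pivots i < nsmons)%N.
Proof.
rewrite nsmonsE; have: all (fun p => p < 805)%N kernel_pivots by vm_compute.
by move/all_nthP; apply; exact: ltn_ord.
Qed.

Definition kernel_pivot (i : 'I_12) : 'I_nsmons := Ordinal (kernel_pivot_lt i).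

Lemma kernel_vec_pivot (i i' : 'I_12) :
  kernel_vec i (kernel_pivot i') 0 = (i == i')%:R.
Proof.
have iota12 (j : 'I_12) : val j \in iota 0 12 by rewrite mem_iota ltn_ord.
have /allP/(_ _ (iota12 i))/andP[/allP/(_ _ (iota12 i'))/Z.eqb_eq E _] :=
  kernel_pivots_ok.
by rewrite mxE E -val_eqE /=; case: (_ == _).
Qed.

Lemma kernel_vec_out (i : 'I_12) (k : 'I_nsmons) :
  (kernel_pivot i < k)%N -> kernel_vec i k 0 = 0.
Proof.
move=> lt_k; have i12 : val i \in iota 0 12 by rewrite mem_iota ltn_ord.
have /allP/(_ _ i12)/andP[_ /allP/(_ (val k))] := kernel_pivots_ok.
have -> : val k \in iota (kernel_pivot i).+1 (804 - kernel_pivot i).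
  have H p q : (q < 805 -> q < p.+1 + (804 - p))%N by lia.
  by rewrite mem_iota lt_k; apply: H; exact: ltn_smons.
by move/(_ isT); rewrite -ratZ_eq0 mxE => /eqP.
Qed.

Lemma kernel_vec_satisfied (i : 'I_12) :
  \sum_j kernel_vec i j 0 *: expansion (smon211111 j) = 0.
Proof.
set M := nth (PositiveMap.Leaf Z) kernel_maps i.
apply/malgP => d; rewrite mcoeff0.
rewrite -(@dot_smons (fun p => ratZ (kernel_coeff M p))) => [|j]; last by rewrite mxE.
rewrite -ratZ_kernel_dot /entry.
case E : (PositiveMap.find _ _) => [r|] //=.
have /List.forallb_forall H0 := kernel_maps_annihilate.
move: (H0 _ (PositiveMap.elements_correct _ _ E)) => /all_nthP H.
by apply/eqP; rewrite ratZ_eq0; apply: H; exact: ltn_ord.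
Qed.

Lemma pivot_dmons_sub d : d \in pivot_dmons -> d \in dmons211111.
Proof.
move/(allP pivot_dmons_content); case: d => [[l c] r].
exact: mem_dmons211111.
Qed.

Lemma dot_kernel (v : 'cV_nsmons) d : E211111 *m v = 0 -> d \in dmons211111 ->
  dot (weight v) (entry (expansion_map 0 smons) (dmon_code d)) = 0.
Proof.
move=> Ev d_in; rewrite (@dot_smons _ v) => [|j]; last exact: weightE.
have lt_d : (index d dmons211111 < size dmons211111)%N by rewrite index_mem.
have /colP/(_ (Ordinal lt_d)) := Ev.
by rewrite E211111_mul [RHS]mxE nth_index.
Qed.

Lemma kernel_pivots_determine (v : 'cV_nsmons) : E211111 *m v = 0 ->
  (forall i, v (kernel_pivot i) 0 = 0) -> v = 0.
Proof.
move=> Ev v0; apply: weight_eq0.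
apply: (@back_substitution _ 805 [seq pos p | p <- kernel_pivots] echelon_map).
- apply: eliminate_annihilated; last first.
    by move=> p; rewrite /entry PositiveMap.gempty dot_nil.
  rewrite all_map; apply/allP => d d_in; apply/eqP; apply: dot_kernel => //.
  exact: pivot_dmons_sub.
- move=> p; rewrite has_map => /hasP[q /(nthP 0)[i]].
  rewrite -[size kernel_pivots]/12%N => lt_i <- /Pos.eqb_eq ->.
  by rewrite (weightE v (kernel_pivot (Ordinal lt_i))) v0.
- by move=> p; rewrite -nsmonsE; exact: weight_out.
- exact: echelon_map_leads.
Qed.

Lemma kernel_vec_mul (i : 'I_12) : E211111 *m kernel_vec i = 0.
Proof.
by apply/colP => d; rewrite E211111_mul kernel_vec_satisfied mcoeff0 mxE.
Qed.

Lemma size_dmons211111 : (nsmons - 12 <= size dmons211111)%N.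
Proof.
rewrite size_allpairs words211111E size_iota nsmonsE.
by have -> : size words = 2520%N by vm_compute.
Qed.

Lemma kernel_vecP (v : 'cV_nsmons) : E211111 *m v = 0 <->
  v = \sum_i v (kernel_pivot i) 0 *: kernel_vec i.
Proof.
exact: kernel_dataP kernel_vec_pivot kernel_vec_mul kernel_pivots_determine v.
Qed.

Lemma N211111P h : N211111 h <-> exists2 v, E211111 *m v = 0 & h = lin_comb v.
Proof.
split=> [[/V211111P[v ->] /satisfied_lin_comb sv]|[v /kernel_vecP vE ->]].
  by exists v => //; apply/colP => i; rewrite E211111_mul sv mcoeff0 mxE.
split; first by apply/V211111P; exists v.
apply/satisfied_lin_comb; rewrite vE.
under eq_bigr => j _ do rewrite summxE scaler_suml.
rewrite exchange_big big1 //= => i _.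
under eq_bigr => j _ do rewrite mxE -scalerA.
by rewrite -scaler_sumr kernel_vec_satisfied scaler0.
Qed.

Lemma lin_comb_sum (I : Type) (r : seq I) (c : I -> rat)
    (f : I -> 'cV[rat]_nsmons) :
  \sum_(i <- r) c i *: lin_comb (f i) = lin_comb (\sum_(i <- r) c i *: f i).
Proof.
elim/big_rec2: _ => [|i x y _ ->]; last by rewrite lin_comb_is_linear.
exact/esym/(linear_at0 lin_comb_is_linear).
Qed.

(** * The canonical basis and its elements with 60 terms *)

Section CanonicalBasis.
Variable R : 'M[rat]_(size dmons211111, nsmons).
Hypothesis R_free : forall j,
  free_column R j = (j \in [seq kernel_pivot i | i <- enum 'I_12]).
Hypothesis R_solution : forall i,
  canonical_solution R (kernel_pivot i) = kernel_vec i.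

Let kernel_pivot_inj : injective kernel_pivot.
Proof. exact: kernel_data_injective kernel_vec_pivot. Qed.

Let js := enum (free_column R).

Let perm_js : perm_eq js [seq kernel_pivot i | i <- enum 'I_12].
Proof.
apply: uniq_perm; first exact: enum_uniq.
  by rewrite (map_inj_uniq kernel_pivot_inj) enum_uniq.
by move=> j; rewrite mem_enum -R_free.
Qed.

Lemma perm_canonical_basis :
  perm_eq (canonical_basis R) [seq lin_comb (kernel_vec i) | i <- iota 0 12].
Proof.
pose g j := lin_comb (canonical_solution R j).
have -> : [seq lin_comb (kernel_vec i) | i <- iota 0 12] =
    [seq g j | j <- [seq kernel_pivot i | i <- enum 'I_12]].
  rewrite -(val_enum_ord 12) -(map_comp g kernel_pivot).
  rewrite -(map_comp (fun i => lin_comb (kernel_vec i)) val).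
  apply: eq_map => i.
  exact/esym/(congr1 lin_comb)/R_solution.
exact: (perm_map g perm_js).
Qed.

Lemma size_canonical_basis : size (canonical_basis R) = 12%N.
Proof. by rewrite (perm_size perm_canonical_basis) size_map size_iota. Qed.

Lemma is_basis_canonical_basis : is_basis N211111 (canonical_basis R).
Proof.
have js_uniq : uniq js by exact: enum_uniq.
pose sol := canonical_solution R.
have solE j j' : j \in js -> j' \in js -> sol j j' 0 = (j == j')%:R.
  rewrite !(perm_mem perm_js) => /mapP[i _ ->] /mapP[i' _ ->].
  by rewrite /sol R_solution kernel_vec_pivot (inj_eq kernel_pivot_inj).
have size_js : size (canonical_basis R) = size js by rewrite size_map.
pose j0 := kernel_pivot ord0; pose nj (i : 'I_(size (canonical_basis R))) := nth j0 js i.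
have lt_js (i : 'I_(size (canonical_basis R))) : (i < size js)%N.
  by rewrite -size_js.
have basisE (i : 'I_(size (canonical_basis R))) :
    (canonical_basis R)`_i = lin_comb (sol (nj i)).
  exact: (nth_map j0).
have sumE (c : 'I_(size (canonical_basis R)) -> rat) :
    \sum_i c i *: (canonical_basis R)`_i = lin_comb (\sum_i c i *: sol (nj i)).
  by rewrite -lin_comb_sum; apply: eq_bigr => i _; rewrite basisE.
split=> [c|h].
  rewrite sumE => /lin_comb_eq0 c0 i; have /colP/(_ (nj i)) := c0.
  have scaleE k : (c k *: sol (nj k)) (nj i) 0 = c k * (k == i)%:R.
    by rewrite mxE solE ?mem_nth // nth_uniq // (inj_eq val_inj).
  rewrite summxE (bigD1 i) //= scaleE eqxx mulr1 big1 ?addr0 ?[RHS]mxE // => k ki.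
  by rewrite scaleE (negPf ki) mulr0.
split=> [/N211111P[v /kernel_vecP vE ->]|[c ->]].
  exists (fun i => v (nj i) 0); rewrite sumE; congr lin_comb; rewrite {1}vE.
  transitivity (\sum_(j <- js) v j 0 *: sol j).
    rewrite (perm_big _ perm_js) big_map big_enum.
    by apply: eq_bigr => i _; rewrite -R_solution.
  by rewrite (big_nth j0) big_mkord -size_js.
apply/N211111P; exists (\sum_i c i *: sol (nj i)); last exact: sumE.
rewrite mulmx_sumr; apply: big1 => i _; rewrite -scalemxAr.
have : nj i \in js by rewrite mem_nth.
rewrite (perm_mem perm_js) => /mapP[k _ ->].
have -> : E211111 *m sol (kernel_pivot k) = 0; last exact: scaler0.
by rewrite /sol R_solution; exact: kernel_vec_mul.
Qed.

(** Vectors 6 to 10 involve the monomials with leftmost letter b, c, d, e, f respectively, the other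
    seven those with leftmost letter a. *)
Lemma nterms_kernel_vec :
  all (fun i => (nterms (lin_comb (kernel_vec i)) == 60) == (5 < i < 11))%N
    (iota 0 12).
Proof.
pose count_terms M := count
  (fun k => ~~ Z.eqb (kernel_coeff M (pos k)) 0) (iota 0 805).
have : all (fun i => (count_terms (nth (PositiveMap.Leaf Z) kernel_maps i) == 60)
    == (5 < i < 11))%N (iota 0 12) by vm_cast_no_check (erefl true).
apply: sub_all => i; rewrite /nterms coordsK /count_terms.
set p := (fun k => _); suff -> : #|[set j | kernel_vec i j 0 != 0]%SET| =
    count p (iota 0 805) by [].
rewrite cardsE -sum1_card -sum1_count -nsmonsE -[X in iota 0 X]subn0.
rewrite -/(index_iota 0 nsmons) big_mkord; apply: eq_bigl => j.
by rewrite unfold_in mxE ratZ_eq0.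
Qed.

Lemma perm_basis60 :
  perm_eq [seq h <- canonical_basis R | nterms h == 60%N]
    [seq lin_comb (kernel_vec i) | i <- iota 6 5].
Proof.
apply: perm_trans (perm_filter _ perm_canonical_basis) _.
rewrite filter_map (@eq_in_filter _ _ (fun i => 5 < i < 11)%N) //.
by move=> i /(allP nterms_kernel_vec)/eqP.
Qed.
End CanonicalBasis.

(** * The five identities with 60 terms *)

Section Transpositions.
Variable T : finType.
Implicit Types (A : seq T) (c : seq (T * T)).

(* Every permutation of the elements of x :: A is, in exactly one way, a      *)
(* permutation of those of A followed by a transposition of x with y.         *)
Fixpoint transpositions A : seq (seq (T * T)) :=
  if A is x :: A' then [seq (x, y) :: c | y <- x :: A', c <- transpositions A']
  else [:: [::]].

Definition chain_perm c : {perm T} :=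
  foldr (fun p s => s * tperm p.1 p.2)%g 1%g c.

Definition chain_sign c : bool := odd (count (fun p => p.1 != p.2) c).

Definition chain_fun c (z : T) : T :=
  foldr (fun p z => if z == p.1 then p.2 else if z == p.2 then p.1 else z) z c.

Lemma chain_permE c z : chain_perm c z = chain_fun c z.
Proof.
elim: c => [|p c IH] /=; first by rewrite perm1.
rewrite permM IH; case: tpermP => [->|->|/eqP/negPf-> /eqP/negPf->] //.
  by rewrite eqxx.
by rewrite eqxx; case: eqP.
Qed.

Lemma odd_chain_perm c : chain_perm c = chain_sign c :> bool.
Proof.
elim: c => [|p c IH] /=; first by rewrite odd_perm1.
by rewrite odd_permM odd_tperm IH /chain_sign /= oddD addbC; case: (_ != _).
Qed.

Lemma sum_transpositions (U : nmodType) (F : {perm T} -> U) A : uniq A ->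
  \sum_(s | perm_on [set x in A]%SET s) F s =
  \sum_(c <- transpositions A) F (chain_perm c).
Proof.
elim: A F => [|x A IH] F.
  rewrite /= big_seq1 (big_pred1 1%g) // => s.
  apply/idP/eqP => [/fintype.subsetP s0|->]; last exact: perm_on1.
  apply/permP => x; rewrite perm1; apply/eqP.
  by have := s0 x; rewrite !inE; case: eqP => // _ /(_ isT).
rewrite cons_uniq => /andP[xA uA].
rewrite -[transpositions _]/[seq (x, y) :: c | y <- x :: A, c <- transpositions A].
rewrite big_allpairs_dep.
(* The sum is split by the image [y] of [x]; composing with the transposition of [x] and [y] leaves
   a permutation that fixes [x]. *)
rewrite (partition_big (fun s : {perm T} => s x) (mem (x :: A))) /=; last first.
  move=> s sA; have [->|sx] := eqVneq (s x) x; first by rewrite mem_head.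
  by have := perm_closed x sA; rewrite !inE eqxx => ->.
rewrite -big_uniq /=; last by rewrite xA.
apply: eq_big_seq => y yA.
rewrite -(IH (fun s => F (s * tperm x y)%g) uA).
rewrite (reindex_inj (mulIg (tperm x y))) /=; apply: eq_bigl => s.
have tA : perm_on [set z in x :: A]%SET (tperm x y).
  apply/fintype.subsetP => z; rewrite !inE.
  by case: (tpermP x y z) => [->|->|_ _]; rewrite ?eqxx // -in_cons.
apply/andP/idP => [[sA /eqP]|sA].
  rewrite permM => E; have sx : s x = x by apply: (perm_inj (s := tperm x y)); rewrite E tpermL.
  have {}sA : perm_on [set z in x :: A]%SET s.
    by rewrite -[s](mulgK (tperm x y)); apply: perm_onM => //; rewrite tpermV.
  apply/fintype.subsetP => z sz; have := fintype.subsetP sA z sz.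
  rewrite !inE => /orP[/eqP zx|//].
  by rewrite zx !inE sx eqxx in sz.
split; last by rewrite permM (out_perm sA) ?inE // tpermL.
apply: perm_onM => //; apply: fintype.subset_trans sA _.
by apply/fintype.subsetP => z; rewrite !inE => ->; rewrite orbT.
Qed.
End Transpositions.

(** * The alternating sums as lists of monomials *)

Fixpoint tmap (X Y : Type) (f : X -> Y) (t : tmon X) : tmon Y :=
  match t with
  | TVar x => TVar (f x)
  | TNode a b c => TNode (tmap f a) (tmap f b) (tmap f c)
  end.

Lemma tmon_eval_tmap (X Y : Type) (A : ternaryAlgebra) (x : Y -> A)
    (f : X -> Y) t : tmon_eval x (tmap f t) = tmon_eval (fun i => x (f i)) t.
Proof. by elim: t => //= a -> b -> c ->. Qed.

Lemma interchange_is_linear y z : linear (Defs.interchange y z).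
Proof. exact: PATA_eval_is_linear (freePATA_isPATA _). Qed.

Lemma interchange_mon y z t :
  Defs.interchange y z (PATA_mon t) = PATA_mon (tmap (tperm y z) t).
Proof.
apply: etrans (PATA_eval_mon _ (freePATA_isPATA _) t) _.
apply: etrans (esym (tmon_eval_tmap _ _ t)) _.
exact: esym (PATA_monE _).
Qed.

(** The factor 12 clears denominators. The weights 3, 1, 1, 2 offset the 4, 12, 12, 6 permutations
    giving the same straightened monomial up to sign, so every nonzero coefficient becomes 12 or
    -12. Terms in which the permuted a meets the fixed a in an alternating pair vanish, which leaves
    24 + 10 + 10 + 16 = 60 monomials. *)
Definition I_terms (s : letter -> letter) : seq (Z * tmon letter) :=
  let v x := TVar (s x) in let b := TVar lb in let a := TVar la in
  [:: (Zpos 3, TNode (TNode (TNode b (v la) (v lc)) a (v ld)) (v le) (v lf));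
      (Zneg 1, TNode (TNode b (TNode (v la) (v lc) (v ld)) a) (v le) (v lf));
      (Zneg 1, TNode (TNode b (v la) (v lc)) (TNode (v ld) (v le) (v lf)) a);
      (Zneg 2, TNode b (TNode (TNode (v la) (v lc) (v ld)) a (v le)) (v lf))].

Definition I_chains : seq (seq (letter * letter)) :=
  transpositions [:: la; lc; ld; le; lf].

Lemma fix_lb (s : 'S_6) :
  (s lb == lb) = perm_on [set x in [:: la; lc; ld; le; lf]]%SET s.
Proof.
have inE x : (x \in [set x in [:: la; lc; ld; le; lf]]%SET) = (x != lb).
  by rewrite !inE; case: x => [[|[|[|[|[|[|]]]]]]].
apply/idP/idP => [/eqP sb|/out_perm->//]; last by rewrite inE eqxx.
by apply/fintype.subsetP => x; rewrite inE; apply: contraNneq => ->; apply/eqP.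
Qed.

Definition PATA_terms (s : seq (Z * tmon letter)) : freePATA letter :=
  \sum_(x <- s) ratZ x.1 *: PATA_mon x.2.

Definition swap (y z x : letter) : letter :=
  if x == y then z else if x == z then y else x.

(* The 480 terms of 12 I^(x). *)
Definition I211111_terms (x : letter) : seq (Z * tmon letter) :=
  flatten [seq [seq ((if chain_sign c then Z.opp p.1 else p.1),
                     tmap (swap lb x) p.2)
               | p <- I_terms (chain_fun c)] | c <- I_chains].

Lemma eq_I_terms f g : f =1 g -> I_terms f = I_terms g.
Proof. by move=> fg; rewrite /I_terms !fg. Qed.

Lemma sum_quarter_twelfth_sixth (U : lmodType rat) (I : finType) (P : pred I)
    (e : I -> rat) (m1 m2 m3 m4 : I -> U) :
  let alt m := \sum_(i | P i) e i *: m i in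
  12 *: (4^-1 *: alt m1 - 12^-1 *: alt m2 - 12^-1 *: alt m3 - 6^-1 *: alt m4) =
  alt (fun i => 3 *: m1 i - m2 i - m3 i - 2 *: m4 i).
Proof.
move=> alt; rewrite /alt !scalerBr !scalerA.
under [RHS]eq_bigr => i _ do rewrite !scalerBr ![e i *: (_ *: _)]scalerA.
rewrite !sumrB divff // !scale1r !scaler_sumr.
congr (_ - _ - _ - _); apply: eq_bigr => i _; rewrite scalerA mulrC; congr (_ *: _).
Qed.

Lemma sum_I_terms (U : lmodType rat) (F : tmon letter -> U) t1 t2 t3 t4 :
  \sum_(x <- [:: (Zpos 3, t1); (Zneg 1, t2); (Zneg 1, t3); (Zneg 2, t4)])
    ratZ x.1 *: F x.2 = 3 *: F t1 - F t2 - F t3 - 2 *: F t4.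
Proof.
rewrite !big_cons big_nil /= addr0 !addrA.
have -> : ratZ (Zneg 1) = -1 by [].
have -> : ratZ (Zneg 2) = -2 by [].
by rewrite !scaleN1r scaleNr.
Qed.

Lemma PATA_I_terms (s : letter -> letter) (x := @PATA_gen letter) :
  PATA_terms (I_terms s) =
  3 *: tprod (tprod (tprod (x lb) (x (s la)) (x (s lc))) (x la) (x (s ld)))
         (x (s le)) (x (s lf))
  - tprod (tprod (x lb) (tprod (x (s la)) (x (s lc)) (x (s ld))) (x la))
         (x (s le)) (x (s lf))
  - tprod (tprod (x lb) (x (s la)) (x (s lc)))
         (tprod (x (s ld)) (x (s le)) (x (s lf))) (x la)
  - 2 *: tprod (x lb) (tprod (tprod (x (s la)) (x (s lc)) (x (s ld))) (x la)
         (x (s le))) (x (s lf)).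
Proof.
have ext (U : lmodType rat) (u1 u2 u3 u4 v1 v2 v3 v4 : U) :
    u1 = v1 -> u2 = v2 -> u3 = v3 -> u4 = v4 ->
    3 *: u1 - u2 - u3 - 2 *: u4 = 3 *: v1 - v2 - v3 - 2 *: v4.
  by move=> -> -> -> ->.
apply: etrans (sum_I_terms _ _ _ _ _) _.
by apply: ext; exact: PATA_monE.
Qed.

Lemma I211111_b_terms : 12 *: I211111_b =
  \sum_(c <- I_chains) (-1) ^+ chain_sign c *: PATA_terms (I_terms (chain_fun c)).
Proof.
rewrite [LHS]sum_quarter_twelfth_sixth.
transitivity (\sum_(s : 'S_6 | s lb == lb) (-1) ^+ s *: PATA_terms (I_terms s)).
  by apply: eq_bigr => s _; rewrite PATA_I_terms.
apply: etrans (eq_bigl _ _ fix_lb) _.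
have u5 : uniq [:: la; lc; ld; le; lf] by [].
pose F (s : 'S_6) := (-1) ^+ s *: PATA_terms (I_terms s).
apply: etrans (sum_transpositions F u5) _; rewrite -/I_chains.
apply: eq_bigr => c _.
by rewrite /F odd_chain_perm (eq_I_terms (chain_permE c)).
Qed.

Local Opaque I_chains.

Lemma swapE y z : tperm y z =1 swap y z.
Proof.
move=> x; rewrite /swap; case: tpermP => [->|->|/eqP/negPf-> /eqP/negPf->] //.
  by rewrite eqxx.
by rewrite eqxx; case: eqP.
Qed.

Lemma eq_tmap (X Y : Type) (f g : X -> Y) : f =1 g -> tmap f =1 tmap g.
Proof. by move=> fg; elim=> [x|a IHa b IHb c IHc] /=; rewrite ?fg ?IHa ?IHb ?IHc. Qed.

Lemma interchange_terms x (s : seq (Z * tmon letter)) :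
  Defs.interchange lb x (PATA_terms s) =
  PATA_terms [seq (p.1, tmap (swap lb x) p.2) | p <- s].
Proof.
apply: etrans (linear_sumZ _ _ _ (interchange_is_linear lb x)) _.
rewrite /PATA_terms big_map; apply: eq_bigr => p _; congr (_ *: _).
apply: etrans (interchange_mon lb x p.2) _.
exact: congr1 (eq_tmap (swapE lb x) p.2).
Qed.

Lemma ratZ_sign (e : bool) z : ratZ (if e then Z.opp z else z) = (-1) ^+ e * ratZ z.
Proof.
case: e; last by rewrite mul1r.
by rewrite expr1 -[-1]/(ratZ (Zneg 1)) -ratZ_is_multiplicative; case: z.
Qed.

Lemma PATA_terms_sign e (s : seq (Z * tmon letter)) :
  PATA_terms [seq (if e then Z.opp p.1 else p.1, p.2) | p <- s] =
  (-1) ^+ e *: PATA_terms s.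
Proof.
rewrite /PATA_terms big_map scaler_sumr; apply: eq_bigr => p _.
by rewrite ratZ_sign scalerA.
Qed.

Lemma PATA_terms_flatten (ss : seq (seq (Z * tmon letter))) :
  PATA_terms (flatten ss) = \sum_(s <- ss) PATA_terms s.
Proof.
elim: ss => [|s ss IH] /=; first by rewrite /PATA_terms !big_nil.
by rewrite big_cons -IH /PATA_terms big_cat.
Qed.

Lemma I211111_termsE x : 12 *: I211111 x = PATA_terms (I211111_terms x).
Proof.
have L := interchange_is_linear lb x.
apply: etrans (esym (linearZ_at _ _ L)) _.
rewrite I211111_b_terms PATA_terms_flatten big_map.
apply: etrans (linear_sumZ _ _ _ L) _; apply: eq_bigr => c _.
by rewrite interchange_terms -PATA_terms_sign; congr PATA_terms.
Qed.

(** * Straightening the five identities *)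

Definition sparse_vec (r : sparse) : 'cV[rat]_nsmons :=
  \col_j dot (fun p => (Pos.eqb p (pos j))%:R) r.

Lemma sparse_vec_comb a b r s : sparse_vec (sparse_comb a b r s) =
  ratZ a *: sparse_vec r + ratZ b *: sparse_vec s.
Proof. by apply/colP => j; rewrite !mxE dot_comb. Qed.

Lemma lin_comb_sparse_vec1 z t : t \in smons ->
  lin_comb (sparse_vec [:: (pos (index t smons), z)]) = ratZ z *: PATA_mon t.
Proof.
rewrite -smons211111E => t_in.
have lt_t : (index t smons211111 < nsmons)%N by rewrite index_mem.
have vE j : sparse_vec [:: (pos (index t smons211111), z)] j 0 =
    if j == Ordinal lt_t then ratZ z else 0.
  rewrite mxE dot_cons dot_nil addr0 -val_eqE eq_sym /=.
  case: Pos.eqb_spec => [/SuccNat2Pos.inj->|ne]; first by rewrite eqxx mulr1.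
  by case: eqP => [E|_]; [case: ne; rewrite E | rewrite mulr0].
apply: etrans (eq_bigr _ (fun j _ => congr1 (fun a => a *: _) (vE j))) _.
apply: etrans (sum_delta _ _ _) _; congr (_ *: PATA_mon _).
exact: nth_index.
Qed.

(** The redex shares the list of codes; positions are found by comparing codes, which are lists of
    numbers, rather than trees. *)
Definition straighten (s : seq (Z * tmon letter)) : sparse :=
  (fun codes => foldr (fun x r => foldr (fun y r => sparse_comb (Zpos 1) (Zpos 1)
      [:: (pos (index (tcode y.2) codes), if y.1 then Z.opp x.1 else x.1)] r)
    r (nf tkey x.2)) [::] s) [seq tcode t | t <- smons].

(** Normal monomials of this content all occur in [smons], so [index] finds their true columns. *)
Lemma lin_comb_straighten s :
  all (fun x => perm_eq (tleaves x.2) content211111) s ->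
  lin_comb (sparse_vec (straighten s)) = PATA_terms s.
Proof.
have one : ratZ (Zpos 1) = 1 by [].
have combE r1 r2 :
    lin_comb (sparse_vec (sparse_comb (Zpos 1) (Zpos 1) r1 r2)) =
    lin_comb (sparse_vec r1) + lin_comb (sparse_vec r2).
  by rewrite sparse_vec_comb !one !scale1r -[in LHS](scale1r (sparse_vec r1))
    lin_comb_is_linear scale1r.
have nilE : lin_comb (sparse_vec [::]) = 0.
  rewrite -[RHS](linear_at0 lin_comb_is_linear); congr lin_comb.
  by apply/colP => j; rewrite !mxE dot_nil.
have code_inj : injective tcode by exact: tkey_inj.
rewrite /straighten; elim: s => [|[z t] s IH]; first by rewrite /PATA_terms big_nil.
case/andP=> pt /IH Es; rewrite /PATA_terms big_cons -/(PATA_terms s) -Es /=.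
have -> : PATA_mon t = signed_sum (@PATA_mon letter) (nf tkey t).
  apply: etrans (PATA_monE t) _.
  apply: etrans (tmon_eval_nf tkey_inj _ (freePATA_isPATA _) t) _.
  by apply: eq_signed_sum => t'; exact/esym/PATA_monE.
have: all (fun y => y.2 \in smons) (nf tkey t).
  apply/allP => y ny; apply: top_normal_smons; first exact: nf_normal ny.
  exact: perm_trans (nf_leaves ny) pt.
elim: (nf tkey t) => [|[e t'] l IHl]; first by rewrite signed_sum_nil scaler0 add0r.
case/andP=> st' /IHl El; rewrite /= combE El (index_map code_inj).
rewrite (lin_comb_sparse_vec1 _ st') ratZ_sign signed_sum_cons scalerDr scalerA.
by rewrite [ratZ z * _]mulrC addrA.
Qed.

Definition sparse_get (r : sparse) (p : positive) : Z :=
  foldr (fun x s => if Pos.eqb x.1 p then Z.add x.2 s else s) Z0 r.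

Lemma sparse_vecE r j : sparse_vec r j 0 = ratZ (sparse_get r (pos j)).
Proof.
rewrite mxE; elim: r => [|[i z] r IH] /=; first by rewrite dot_nil.
rewrite dot_cons IH; case: (Pos.eqb _ _); last by rewrite mulr0 add0r.
by rewrite mulr1 ratZ_is_additive.
Qed.

Definition I_letters : seq letter := [:: lb; lc; ld; le; lf].
(** The sign is that of the permutation sorting the images of a, c, d, e, f under the interchange of
    b with the letter in question; 12 is the common absolute value of the coefficients. *)
Definition I_scales : seq Z := [:: Zpos 12; Zpos 12; Zneg 12; Zpos 12; Zneg 12].

Lemma I_terms_leaves : all (fun x =>
  all (fun p => perm_eq (tleaves p.2) content211111) (I211111_terms x)) I_letters.
Proof. by vm_cast_no_check (erefl true). Qed.

Lemma I_straighten : all (fun i =>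
  (fun r => all (fun k => Z.eqb (sparse_get r (pos k))
     (Z.mul (nth Z0 I_scales i)
       (kernel_coeff (nth (PositiveMap.Leaf Z) kernel_maps (6 + i)) (pos k))))
    (iota 0 805)) (straighten (I211111_terms (nth lb I_letters i)))) (iota 0 5).
Proof. by vm_cast_no_check (erefl true). Qed.

Lemma kernel_vec_I211111 (i : 'I_5) : lin_comb (kernel_vec (6 + i)) =
  (12 / ratZ (nth Z0 I_scales i)) *: I211111 (nth lb I_letters i).
Proof.
have i5 : val i \in iota 0 5 by rewrite mem_iota ltn_ord.
have s0 : ratZ (nth Z0 I_scales i) != 0 by case: i {i5} => [[|[|[|[|[|]]]]]].
rewrite mulrC -scalerA I211111_termsE -lin_comb_straighten; last first.
  apply: (allP I_terms_leaves); apply: mem_nth; exact: ltn_ord.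
have -> : sparse_vec (straighten (I211111_terms (nth lb I_letters i))) =
    ratZ (nth Z0 I_scales i) *: kernel_vec (6 + i).
  apply/colP => k; rewrite sparse_vecE.
  have /allP/(_ _ i5)/allP/(_ (val k)) := I_straighten.
  rewrite mem_iota ltn_smons => /(_ isT)/Z.eqb_eq ->.
  by rewrite ratZ_is_multiplicative !mxE.
rewrite (linearZ_at _ _ lin_comb_is_linear).
by rewrite scalerA mulVf // scale1r.
Qed.

Theorem theorem8p5 :
  has_dim N211111 12 /\
  exists2 R : 'M[rat]_(size dmons211111, size smons211111),
    row_canonical_form E211111 R &
    let basis := canonical_basis R in
    let basis60 := [seq h <- basis | nterms h == 60%N] in
    [/\ is_basis N211111 basis,
        size basis = 12%N,
        size basis60 = 5%N &
        exists2 s : seq (freePATA letter), perm_eq s basis60 &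
          forall k : 'I_5, exists2 c : rat, c != 0 &
            s`_k = c *: I211111 (nth lb [:: lb; lc; ld; le; lf] k)].
Proof.
have [R RE [RF RS]] := row_canonical_form_kernel kernel_vec_pivot
  kernel_vec_out kernel_vec_mul kernel_pivots_determine size_dmons211111.
have basisR := is_basis_canonical_basis RF RS.
have size_basis := size_canonical_basis RF RS.
have basis60 := perm_basis60 RF RS.
split; first by exists (canonical_basis R).
exists R => //; split => //.
  by rewrite (perm_size basis60) size_map size_iota.
exists [seq lin_comb (kernel_vec i) | i <- iota 6 5]; first by rewrite perm_sym.
(* The scalar is 1 or -1. *)
move=> k; exists (12 / ratZ (nth Z0 I_scales k)).
  by case: k => [[|[|[|[|[|]]]]]].
rewrite (nth_map 0%N) ?size_iota // nth_iota //.
exact: kernel_vec_I211111.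
Qed.
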